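(* For every $n\in\mathbb{N}$ with $n\neq 2,3$: (i) there exists a simplicial complex $X_{2n}$ with $8n-1$ vertices and $\pi_1(X_{2n})\cong\mathbb{Z}^{2n}$; (ii) there exists a simplicial complex $X_{2n-1}$ with $8n-3$ vertices and $\pi_1(X_{2n-1})\cong\mathbb{Z}^{2n-1}$. In particular, for every $m$ there is a simplicial complex on $O(m)$ vertices with fundamental group $\mathbb{Z}^m$.
   Context: Fundamental groups of (possibly disconnected) complexes are taken at a suitable basepoint. *)

(* Defs.v *)
From HB Require Import structures.
From mathcomp Require Import all_boot all_order all_algebra.
From mathcomp Require Import all_classical all_reals all_analysis.
From mathcomp Require Import Rstruct Rstruct_topology.
Notation R := Rdefinitions.R.

Set Implicit Arguments.
Unset Strict Implicit.
Unset Printing Implicit Defensive.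

Import Order.TTheory GRing.Theory Num.Theory.
Local Open Scope classical_set_scope.
Local Open Scope ring_scope.

Definition is_simplicial_complex (N : nat) (K : {set {set 'I_N}}) : Prop :=
  (forall s : {set 'I_N}, s \in K -> s != finset.set0) /\
  (forall s t : {set 'I_N}, s \in K -> t \subset s -> t != finset.set0 -> t \in K).

Definition has_vertex_set_all (N : nat) (K : {set {set 'I_N}}) : Prop :=
  forall i : 'I_N, finset.set1 i \in K.

Definition unitI : set R := [set t : R | 0 <= t <= 1].
Definition unitSq : set (R * R) := [set p : R * R | 0 <= p.1 <= 1 /\ 0 <= p.2 <= 1].

(* Geometric realization |K| inside the standard simplex of R^N
   (barycentric coordinates), with the subspace topology of 'rV[R]_N. *)
Definition realization (N : nat) (K : {set {set 'I_N}}) : set 'rV[R]_N :=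
  [set x | (forall i, 0 <= x ord0 i) /\ (\sum_i x ord0 i = 1) /\
           finset.finset (fun i => x ord0 i != 0) \in K].

Definition is_loop (N : nat) (K : {set {set 'I_N}}) (x0 : 'rV[R]_N)
    (g : R -> 'rV[R]_N) : Prop :=
  {within unitI, continuous g} /\
  (forall t, unitI t -> realization K (g t)) /\ g 0 = x0 /\ g 1 = x0.

Definition loop_homotopic (N : nat) (K : {set {set 'I_N}}) (x0 : 'rV[R]_N)
    (a b : R -> 'rV[R]_N) : Prop :=
  exists H : R * R -> 'rV[R]_N,
    {within unitSq, continuous H} /\
    (forall p, unitSq p -> realization K (H p)) /\
    (forall t, unitI t -> H (0, t) = a t /\ H (1, t) = b t) /\
    (forall s, unitI s -> H (s, 0) = x0 /\ H (s, 1) = x0).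

Definition loop_concat (N : nat) (a b : R -> 'rV[R]_N) : R -> 'rV[R]_N :=
  fun t => if t <= 2^-1 then a (2 * t) else b (2 * t - 1).

(* pi_1(|K|, x0) is isomorphic to Z^m: a map from loops to Z^m that induces
   a bijection from homotopy classes of loops and sends concatenation to
   addition (i.e. a group isomorphism pi_1(|K|,x0) -> Z^m, unfolded). *)
Definition pi1_iso_Zpow (N : nat) (K : {set {set 'I_N}}) (x0 : 'rV[R]_N)
    (m : nat) : Prop :=
  exists phi : (R -> 'rV[R]_N) -> 'rV[int]_m,
    (forall a b, is_loop K x0 a -> is_loop K x0 b ->
       (phi a = phi b <-> loop_homotopic K x0 a b)) /\
    (forall z : 'rV[int]_m, exists a, is_loop K x0 a /\ phi a = z) /\
    (forall a b, is_loop K x0 a -> is_loop K x0 b ->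
       phi (loop_concat a b) = phi a + phi b).

Definition complex_with_pi1_Zpow (N m : nat) : Prop :=
  exists K : {set {set 'I_N}},
    is_simplicial_complex K /\ has_vertex_set_all K /\
    exists x0, realization K x0 /\ pi1_iso_Zpow K x0 m.

(* Main.v *)
(** Each generator of [Z^m] is carried by a triangle through a common base point. The edges
    of the complete graph on the generators are properly coloured; each colour [f] gets two
    auxiliary vertices [x_f], [y_f], and for every pair [i < j] of colour [f] the base point,
    the four other vertices of the two triangles and [x_f], [y_f] are made into the
    seven-vertex torus, so that the generators [i] and [j] commute. The labels are chosen so
    that the base point, [x_f] and [y_f] span a face. Hence the tori of one colour may share
    it, and a single proper edge colouring (rather than a pair of orthogonal ones) is enough.

    The degree of a loop is the sum of an integral 1-cocycle over the main vertices (those of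
    large barycentric coordinate) of a fine enough sampling; on a fine grid over a homotopy the
    main vertices of a small square lie in one simplex, which gives homotopy invariance.
    Conversely a loop is homotopic, by a straight-line homotopy, to the polygon through its
    sampled main vertices, and edge paths with equal degree are related by elementary moves
    across triangles. *)
Require Import Defs.
From mathcomp Require Import all_boot all_order all_algebra.
From mathcomp Require Import all_classical all_reals all_analysis.
From mathcomp Require Import Rstruct Rstruct_topology ring lra zify.
Set Implicit Arguments.
Unset Strict Implicit.
Unset Printing Implicit Defensive.
Import Order.TTheory GRing.Theory Num.Theory numFieldNormedType.Exports.
Local Open Scope classical_set_scope.
Local Open Scope ring_scope.

(** * Uniform continuity on compact sets and continuity of elementary constructions *)

Lemma compact_uniform (X : pseudoMetricType R) (N : nat) (A : set X)
    (G : X -> 'rV[R]_N) (e : R) :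
  compact A -> continuous G -> 0 < e ->
  exists M0 : nat, forall M, (M0 <= M)%N -> forall x y, A x ->
    ball x M.+1%:R^-1 y -> forall i, `|G x ord0 i - G y ord0 i| < e.
Proof.
move=> /compact_near_coveringP cA cG e0.
pose P (M : nat) (x : X) := forall y, ball x M.+1%:R^-1 y ->
  forall i, `|G x ord0 i - G y ord0 i| < e.
have := cA nat \oo P (@eventually_filter).
have HP : forall x, A x -> \forall x' \near x & M \near \oo, P M x'.
  move=> x _.
  have e2 : 0 < e / 2 by lra.
  have /cvg_ballP/(_ _ e2) := cG x.
  rewrite -nbhs_ballE => -[r /= r0 Hr].
  have r2 : 0 < r / 2 by lra.
  (* Half of the radius [r] is spent on [x'] and half on [y], so both stay within [r] of [x]; [y]
     itself may lie outside [A]. *)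
  exists (ball x (r / 2), [set M : nat | M.+1%:R^-1 < r / 2]) => /=.
    split; first by apply: nbhsx_ballx.
    have [M1 _ HM1] := near_infty_natSinv_lt (PosNum r2).
    by exists M1 => //= M /HM1.
  move=> [x' M] /= [bx HM] y bxy i.
  have H1 : ball (G x) (e / 2) (G x') by apply: Hr; apply: le_ball bx; lra.
  have H2 : ball (G x) (e / 2) (G y).
    apply: Hr; rewrite (splitr r); apply: ball_triangle bx _.
    by apply: le_ball bxy; exact: ltW.
  have := H1.2 ord0 i; have := H2.2 ord0 i.
  rewrite /ball /= => h1 h2.
  have -> : G x' ord0 i - G y ord0 i =
    (G x ord0 i - G y ord0 i) - (G x ord0 i - G x' ord0 i) by lra.
  apply: le_lt_trans (ler_normB _ _) _; lra.
move=> /(_ HP) [M0 _ H]; exists M0 => M hM x y Ax b i.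
exact: (H M hM x Ax y b i).
Qed.

(** A retraction of the line onto the unit interval. Precomposing with it turns a loop or homotopy
    that is continuous only within the interval or square into a map continuous everywhere. *)
Definition clamp (x : R) : R := Num.max 0 (Num.min x 1).

Lemma clamp_cont : continuous clamp.
Proof.
move=> x; apply: (@continuous_max R R (fun=> 0) (fun y => Num.min y 1)).
  exact: cvg_cst.
apply: (@continuous_min R R id (fun=> 1)); [exact: cvg_id | exact: cvg_cst].
Qed.

Lemma clampI x : 0 <= clamp x <= 1.
Proof.
rewrite /clamp le_max lexx /= ge_max ler01 /=.
by rewrite ge_min lexx orbT.
Qed.

Lemma clamp_id x : 0 <= x <= 1 -> clamp x = x.
Proof. by case/andP=> h0 h1; rewrite /clamp min_l // max_r. Qed.

Lemma clamp0 x : x <= 0 -> clamp x = 0.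
Proof. by move=> h; rewrite /clamp min_l ?max_l //; lra. Qed.

Lemma clamp1 x : 1 <= x -> clamp x = 1.
Proof. by move=> h; rewrite /clamp min_r ?max_r. Qed.

Lemma within_comp (X Y Z : topologicalType) (A : set Y) (f : Y -> Z) (r : X -> Y) :
  {within A, continuous f} -> continuous r -> (forall x, A (r x)) ->
  continuous (f \o r).
Proof.
move=> /subspace_continuousP cf cr Ar x U /(cf _ (Ar x)) => HU.
have := cr x _ HU; rewrite /= !nbhs_simpl /=.
by apply: filterS => y /=; apply; exact: Ar.
Qed.

Lemma fst_cont : continuous (fun p : R * R => p.1).
Proof. by move=> [x y]; apply: cvg_fst. Qed.

Lemma snd_cont : continuous (fun p : R * R => p.2).
Proof. by move=> [x y]; apply: cvg_snd. Qed.

Lemma affine_cont (X : topologicalType) (f : X -> R) (a b : R) :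
  continuous f -> continuous (fun x => a * f x + b).
Proof.
move=> cf x; apply: (@cvgD R R^o); last exact: cvg_cst.
by apply: cvgM; [exact: cvg_cst | exact: cf].
Qed.

Lemma comp_cont (X Y Z : topologicalType) (f : X -> Y) (g : Y -> Z) :
  continuous f -> continuous g -> continuous (fun x => g (f x)).
Proof. by move=> cf cg x; apply: continuous_comp; [exact: cf | exact: cg]. Qed.

Lemma pair_cont (X Y Z : topologicalType) (f : X -> Y) (g : X -> Z) :
  continuous f -> continuous g -> continuous (fun x => (f x, g x)).
Proof. by move=> cf cg x; apply: cvg_pair; [exact: cf | exact: cg]. Qed.

Lemma add_cont (X : topologicalType) N (f g : X -> 'rV[R]_N) :
  continuous f -> continuous g -> continuous (fun x => f x + g x).
Proof. by move=> cf cg x; apply: cvgD; [exact: cf | exact: cg]. Qed.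

Lemma scale_cont (X : topologicalType) N (f : X -> R) (g : X -> 'rV[R]_N) :
  continuous f -> continuous g -> continuous (fun x => f x *: g x).
Proof. by move=> cf cg x; apply: cvgZ; [exact: cf | exact: cg]. Qed.

Lemma cst_cont (X Y : topologicalType) (y : Y) : continuous (fun _ : X => y).
Proof. by move=> x; exact: cvg_cst. Qed.

Lemma sum_cont (X : topologicalType) N n (f : 'I_n -> X -> 'rV[R]_N) :
  (forall i, continuous (f i)) -> continuous (fun x => \sum_(i < n) f i x).
Proof.
elim: n f => [|n IH] f cf.
  have -> : (fun x => \sum_(i < 0) f i x) = (fun=> 0).
    by apply/funext => x; rewrite big_ord0.
  exact: cst_cont.
have -> : (fun x => \sum_(i < n.+1) f i x) =
    (fun x => f ord0 x + \sum_(i < n) f (lift ord0 i) x).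
  by apply/funext => x; rewrite big_ord_recl.
by apply: add_cont; [exact: cf | apply: IH => i; exact: cf].
Qed.

Lemma unitSq_compact : compact unitSq.
Proof.
have -> : unitSq = `[0, 1]%classic `*` `[0, 1]%classic.
  by apply/seteqP; split => -[x y] /=; rewrite !in_itv.
by apply: compact_setX; exact: segment_compact.
Qed.

Lemma unitI_compact : compact unitI.
Proof.
have -> : unitI = `[0, 1]%classic.
  by apply/seteqP; split => x /=; rewrite in_itv.
exact: segment_compact.
Qed.

(** * Loops in a geometric realization *)

Ltac unit_lra :=
  unfold unitI in *; simpl in *;
  repeat match goal with H : is_true (andb _ _) |- _ => move/andP: H => [? ?] end;
  try (apply/andP; split); lra.

Section Realization.
Variables (N : nat) (K : {set {set 'I_N}}).
Hypothesis scK : is_simplicial_complex K.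
Implicit Types (x y : 'rV[R]_N) (s t u : R).

Definition simplex_pt x := (forall i, 0 <= x ord0 i) /\ \sum_i x ord0 i = 1.

(** The support of [x] is a nonempty face of [sg]: were it empty, the coordinates could not add up
    to 1. *)
Lemma realization_sub (sg : {set 'I_N}) x :
  sg \in K -> simplex_pt x -> (forall i, x ord0 i != 0 -> i \in sg) ->
  realization K x.
Proof.
move=> sgK [x0 x1] sub; split=> //; split=> //.
apply: (scK.2 _ _ sgK).
  by apply/fintype.subsetP => i; rewrite inE; exact: sub.
apply/negP => /eqP E.
have : \sum_i x ord0 i = 0.
  apply: big1 => i _; apply/eqP/negPn/negP => ni.
  have : i \in finset.finset (fun i => x ord0 i != 0) by rewrite inE.
  by rewrite E finset.in_set0.
by rewrite x1 => /eqP; rewrite oner_eq0.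
Qed.

Lemma simplex_mix s x y : 0 <= s <= 1 -> simplex_pt x -> simplex_pt y ->
  simplex_pt ((1 - s) *: x + s *: y).
Proof.
move=> /andP[s0 s1] [x0 x1] [y0 y1]; split=> [i|].
  rewrite !mxE; apply: addr_ge0; apply: mulr_ge0 => //; lra.
under eq_bigr do rewrite !mxE.
by rewrite big_split /= -!mulr_sumr x1 y1; lra.
Qed.

Lemma realization_mix (sg : {set 'I_N}) s x y : sg \in K -> 0 <= s <= 1 ->
  simplex_pt x -> simplex_pt y ->
  (forall i, x ord0 i != 0 -> i \in sg) -> (forall i, y ord0 i != 0 -> i \in sg) ->
  realization K ((1 - s) *: x + s *: y).
Proof.
move=> sgK s01 px py hx hy.
apply: (realization_sub sgK); first exact: simplex_mix.
move=> i; rewrite !mxE; apply: contraR => ni.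
have /eqP -> : x ord0 i == 0 by apply: contraR ni; exact: hx.
have /eqP -> : y ord0 i == 0 by apply: contraR ni; exact: hy.
by rewrite !mulr0 addr0.
Qed.

Lemma realization_pt x : realization K x -> simplex_pt x.
Proof. by case=> h1 [h2 _]. Qed.

Lemma clamp_loop_cont x0 g : is_loop K x0 g -> continuous (fun t => g (clamp t)).
Proof.
by move=> [cg _]; apply: (within_comp cg clamp_cont) => x; exact: clampI.
Qed.

Lemma loop_ext_cont x0 g : continuous g -> 
  (forall t, unitI t -> realization K (g t)) -> g 0 = x0 -> g 1 = x0 ->
  is_loop K x0 g.
Proof.
by move=> cg hg g0 g1; split; [exact: continuous_subspaceT | split].
Qed.

(** At each time the segment joining the two loops stays in a closed simplex, which is convex. The
    simplex may depend on [t] in any way, since the formula of the homotopy does not mention it. *)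
Lemma straight_homotopy x0 a b : is_loop K x0 a -> is_loop K x0 b ->
  (forall t, unitI t -> exists2 sg, sg \in K &
     forall i, (a t ord0 i != 0 -> i \in sg) /\ (b t ord0 i != 0 -> i \in sg)) ->
  loop_homotopic K x0 a b.
Proof.
move=> la lb hab.
have cE s : (-1) * s + 1 = 1 - s :> R by lra.
exists (fun p => ((-1) * p.1 + 1) *: a (clamp p.2) + p.1 *: b (clamp p.2)); split.
  apply: continuous_subspaceT; apply: add_cont; apply: scale_cont.
  - exact: affine_cont fst_cont.
  - exact: (comp_cont snd_cont (clamp_loop_cont la)).
  - exact: fst_cont.
  - exact: (comp_cont snd_cont (clamp_loop_cont lb)).
split=> [[s t] /= [hs ht]|].
  rewrite clamp_id // cE; have [sg sgK hsg] := hab _ ht.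
  apply: (realization_mix sgK) => // [||i|i].
  - by apply: realization_pt; apply: la.2.1.
  - by apply: realization_pt; apply: lb.2.1.
  - by case: (hsg i).
  - by case: (hsg i).
split=> [t ht | s hs] /=.
  by rewrite clamp_id // !cE subr0 !scale1r !scale0r addr0 subrr scale0r add0r.
have h01 : 0 <= (0 : R) <= 1 by rewrite lexx ler01.
have h11 : 0 <= (1 : R) <= 1 by rewrite lexx ler01.
rewrite !clamp_id // la.2.2.1 la.2.2.2 lb.2.2.1 lb.2.2.2.
by rewrite cE -!scalerDl subrK scale1r.
Qed.

Lemma homotopic_sym x0 a b : loop_homotopic K x0 a b -> loop_homotopic K x0 b a.
Proof.
move=> [H [cH [rH [eH bH]]]].
pose r (p : R * R) := ((-1) * clamp p.1 + 1, clamp p.2).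
have cr : continuous r.
  apply: pair_cont; last exact: (comp_cont snd_cont clamp_cont).
  exact: affine_cont (comp_cont fst_cont clamp_cont).
have rI p : unitSq (r p).
  by rewrite /r; split; have := clampI p.1; have := clampI p.2; move=> ? ?; unit_lra.
have h01 : 0 <= (0 : R) <= 1 by rewrite lexx ler01.
have h11 : 0 <= (1 : R) <= 1 by rewrite lexx ler01.
exists (H \o r); split.
  by apply: continuous_subspaceT; exact: (within_comp cH cr).
split=> [p _|]; first exact: rH.
split=> [t ht|s hs] /=; rewrite /r /= !clamp_id //.
  by rewrite mulr0 add0r mulr1 addNr; case: (eH _ ht).
by apply: bH; unit_lra.
Qed.

(* With [H1 (1, t) = H2 (0, t) = b t], the vertical pasting of two homotopies is
   [H1 (clamp (2 s), t) + H2 (clamp (2 s - 1), t) - b t], visibly continuous. *)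
Lemma homotopic_trans x0 a b c : is_loop K x0 b ->
  loop_homotopic K x0 a b -> loop_homotopic K x0 b c -> loop_homotopic K x0 a c.
Proof.
move=> lb [H1 [cH1 [rH1 [eH1 bH1]]]] [H2 [cH2 [rH2 [eH2 bH2]]]].
have h01 : 0 <= (0 : R) <= 1 by rewrite lexx ler01.
have h11 : 0 <= (1 : R) <= 1 by rewrite lexx ler01.
pose r (d : R) (p : R * R) := (clamp (2 * p.1 + d), clamp p.2).
have cr d : continuous (r d).
  apply: pair_cont; last exact: (comp_cont snd_cont clamp_cont).
  apply: comp_cont clamp_cont; exact: affine_cont fst_cont.
have rI d p : unitSq (r d p) by split; exact: clampI.
pose H p := H1 (r 0 p) + (H2 (r (-1) p) + (-1) *: b (clamp p.2)).
have HE s t : unitI s -> unitI t ->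
    H (s, t) = if s <= 2^-1 then H1 (2 * s, t) else H2 (2 * s - 1, t).
  move=> hs ht; rewrite /H /r /= addr0 (clamp_id ht); case: lerP => hs2.
    rewrite (@clamp0 (2 * s - 1)); last lra.
    by rewrite (eH2 _ ht).1 scaleN1r subrr addr0 clamp_id //; unit_lra.
  rewrite (@clamp1 (2 * s)); last by unit_lra.
  rewrite (eH1 _ ht).2 scaleN1r addrC subrK clamp_id //.
  by unit_lra.
exists H; split.
  apply: continuous_subspaceT; apply: add_cont; last apply: add_cont.
  - exact: (within_comp cH1 (cr _) (rI _)).
  - exact: (within_comp cH2 (cr _) (rI _)).
  - apply: scale_cont; first exact: cst_cont.
    exact: (comp_cont snd_cont (clamp_loop_cont lb)).
split=> [[s t] /= [hs ht]|].
  rewrite HE //; case: lerP => h; [apply: rH1 | apply: rH2]; split => //=; unit_lra.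
split=> [t ht | s hs].
  rewrite !HE //= ifT ?ifF; [|lra|lra]; rewrite mulr0 mulr1.
  by split; [case: (eH1 _ ht) | rewrite (_ : 2 - 1 = 1 :> R); [case: (eH2 _ ht) | lra]].
rewrite !HE //; case: lerP => h; [apply: bH1 | apply: bH2]; unit_lra.
Qed.

Lemma homotopic_refl x0 a : is_loop K x0 a -> loop_homotopic K x0 a a.
Proof.
move=> la; apply: straight_homotopy => // t ht.
by have [_ [_ h]] := la.2.1 _ ht; exists (finset.finset (fun i => a t ord0 i != 0)) => [|i]; rewrite ?inE.
Qed.

Lemma loop_concat_loop x0 a b : is_loop K x0 a -> is_loop K x0 b ->
  is_loop K x0 (loop_concat a b).
Proof.
move=> la lb.
(* At every time one of the two clamped loops rests at [x0], so subtracting [x0] once leaves the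
   concatenation, written without a case distinction. *)
pose g t := a (clamp (2 * t + 0)) + (b (clamp (2 * t + -1)) + (-1) *: x0).
have gE t : unitI t -> g t = loop_concat a b t.
  move=> ht; rewrite /g /loop_concat addr0; case: lerP => h.
    rewrite (@clamp0 (2 * t - 1)); last lra.
    by rewrite lb.2.2.1 scaleN1r subrr addr0 clamp_id //; unit_lra.
  rewrite (@clamp1 (2 * t)); last by unit_lra.
  rewrite la.2.2.2 scaleN1r addrC subrK clamp_id //.
  by unit_lra.
have cg : continuous g.
  have cd d : continuous (fun t : R => 2 * t + d).
    by apply: affine_cont => x; exact: cvg_id.
  apply: add_cont; last apply: add_cont.
  - exact: (comp_cont (cd 0) (clamp_loop_cont la)).
  - exact: (comp_cont (cd (-1)) (clamp_loop_cont lb)).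
  - exact: cst_cont.
split.
  apply: (subspace_eq_continuous _ (continuous_subspaceT cg)) => t.
  by rewrite inE => ht; exact: gE.
split=> [t ht|].
  rewrite /loop_concat; case: lerP => h; [apply: la.2.1|apply: lb.2.1];
    by unit_lra.
rewrite /loop_concat ifT ?ifF; [|lra|lra].
rewrite mulr0 mulr1 (_ : 2 - 1 = 1 :> R); last lra.
by split; [exact: la.2.2.1 | exact: lb.2.2.2].
Qed.

End Realization.

(** * Polygonal loops and sampling *)

Section EdgeLoops.
Variables (N : nat) (K : {set {set 'I_N}}) (v0 : 'I_N).
Hypothesis scK : is_simplicial_complex K.
Implicit Types (x y : 'rV[R]_N) (s t u : R) (w : seq 'I_N).

Definition vert (v : 'I_N) : 'rV[R]_N := \row_j (j == v)%:R.

Lemma vertE v i : vert v ord0 i = (i == v)%:R.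
Proof. by rewrite mxE. Qed.

Lemma simplex_vert v : simplex_pt (vert v).
Proof.
split=> [i|]; first by rewrite vertE ler0n.
rewrite (bigD1 v) //= vertE eqxx big1 ?addr0 // => i /negbTE ni.
by rewrite vertE ni.
Qed.

Definition vtx w i := nth v0 w i.

(** While [u] runs from [i] to [i + 1] only the [i]-th clamp moves, from 0 to 1. The telescoping sum
    therefore follows the [i]-th edge at unit speed, and its continuity is immediate. *)
Definition polygon w (L : nat) (u : R) : 'rV[R]_N :=
  vert v0 + \sum_(i < L) clamp (u - i%:R) *: (vert (vtx w i.+1) - vert (vtx w i)).

Definition pl_loop w (L : nat) (t : R) : 'rV[R]_N := polygon w L (L%:R * t).

(** With [a = b] this says that [a] is a vertex of [K], so edge paths may pause. *)
Definition adjacent (a b : 'I_N) := finset.setU (finset.set1 a) (finset.set1 b) \in K.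

(** Lists are read as infinite sequences that end up resting at [v0], so loops of different lengths
    can be compared at a common [L]. *)
Definition edge_loop w (L : nat) :=
  [/\ vtx w 0 = v0, forall i, (L <= i)%N -> vtx w i = v0
    & forall i, adjacent (vtx w i) (vtx w i.+1)].

Lemma polygonS w L u : polygon w L.+1 u =
  polygon w L u + clamp (u - L%:R) *: (vert (vtx w L.+1) - vert (vtx w L)).
Proof. by rewrite /polygon big_ord_recr /= addrA. Qed.

Lemma polygon_full w L u : vtx w 0 = v0 -> L%:R <= u ->
  polygon w L u = vert (vtx w L).
Proof.
move=> w0; elim: L => [|L IH] hu; first by rewrite /polygon big_ord0 addr0 w0.
rewrite polygonS IH; last by apply: le_trans hu; rewrite ler_nat.
rewrite clamp1; last by rewrite -natr1 in hu; lra.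
by rewrite scale1r addrC subrK.
Qed.

Lemma polygon_cut w i L u : (i <= L)%N -> u <= i%:R -> polygon w L u = polygon w i u.
Proof.
move=> /subnK <-; elim: (L - i)%N => [|k IH] hu //.
rewrite addSn polygonS clamp0 ?scale0r ?addr0 ?IH //.
have : i%:R <= (k + i)%:R :> R by rewrite ler_nat leq_addl.
lra.
Qed.

Lemma polygon_seg w i L u : vtx w 0 = v0 -> (i < L)%N -> i%:R <= u <= i.+1%:R ->
  polygon w L u = (1 - (u - i%:R)) *: vert (vtx w i) + (u - i%:R) *: vert (vtx w i.+1).
Proof.
move=> w0 iL /andP[h1 h2]; rewrite (@polygon_cut _ i.+1) // polygonS polygon_full //.
rewrite clamp_id; last by rewrite -natr1 in h2; apply/andP; split; lra.
by move: (u - _) => f; rewrite scalerBr scalerBl scale1r addrA addrAC.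
Qed.

Lemma grid_index L u : (0 < L)%N -> 0 <= u <= L%:R ->
  exists2 i, (i < L)%N & i%:R <= u <= i.+1%:R.
Proof.
elim: L => // -[|L] IH _ /andP[h0 h1]; first by exists 0%N => //; rewrite h0 h1.
case: (lerP u L.+1%:R) => h.
  have [|i iL hi] := IH isT; first by rewrite h0 h.
  by exists i => //; exact: ltnW.
by exists L.+1 => //; rewrite (ltW h) h1.
Qed.

Lemma grid_index01 L t : (0 < L)%N -> unitI t ->
  exists2 i, (i < L)%N & i%:R <= L%:R * t <= i.+1%:R.
Proof.
move=> L0 /andP[t0 t1]; apply: grid_index => //.
by rewrite mulr_ge0 //= ler_piMr.
Qed.

Lemma segment_supp (sg : {set 'I_N}) a b f i : a \in sg -> b \in sg ->
  ((1 - f) *: vert a + f *: vert b) ord0 i != 0 -> i \in sg.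
Proof.
move=> ha hb; rewrite !mxE; apply: contraR => ni.
have /negbTE -> : i != a by apply: contra ni => /eqP ->.
have /negbTE -> : i != b by apply: contra ni => /eqP ->.
by rewrite !mulr0 addr0.
Qed.

Lemma polygon_cont w L : continuous (polygon w L).
Proof.
apply: add_cont; first exact: cst_cont.
apply: sum_cont => i; apply: scale_cont; last exact: cst_cont.
apply: comp_cont clamp_cont => u.
by apply: (@cvgB R R^o); [exact: cvg_id | exact: cvg_cst].
Qed.

Lemma polygon_real w L u : (0 < L)%N -> edge_loop w L -> 0 <= u <= L%:R ->
  realization K (polygon w L u).
Proof.
move=> L0 [w0 wL wadj] hu; have [i iL hi] := grid_index L0 hu.
rewrite (polygon_seg w0 iL hi); apply: (realization_mix scK (wadj i)).
- by move: hi; rewrite -natr1 => /andP[? ?]; apply/andP; split; lra.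
- exact: simplex_vert.
- exact: simplex_vert.
- by move=> j; rewrite vertE pnatr_eq0 eqb0 negbK => /eqP ->; rewrite !inE eqxx.
- by move=> j; rewrite vertE pnatr_eq0 eqb0 negbK => /eqP ->; rewrite !inE eqxx orbT.
Qed.

Lemma polygon0 w L : polygon w L 0 = vert v0.
Proof.
rewrite /polygon big1 ?addr0 // => i _.
by rewrite clamp0 ?scale0r // sub0r oppr_le0 ler0n.
Qed.

Lemma polygonL w L u : edge_loop w L -> L%:R <= u -> polygon w L u = vert v0.
Proof. by move=> [w0 wL _] hu; rewrite polygon_full // wL. Qed.

Lemma mulL_cont (L : nat) : continuous (fun t : R => L%:R * t).
Proof.
have -> : (fun t : R => L%:R * t) = (fun t : R => L%:R * t + 0).
  by apply/funext => t; rewrite addr0.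
by apply: affine_cont => t; exact: cvg_id.
Qed.

Lemma pl_loop_loop w L : (0 < L)%N -> edge_loop w L ->
  is_loop K (vert v0) (pl_loop w L).
Proof.
move=> L0 wl; apply: loop_ext_cont.
- exact: comp_cont (@mulL_cont L) (@polygon_cont w L).
- by move=> t /andP[t0 t1]; apply: polygon_real; rewrite // mulr_ge0 //= ler_piMr.
- by rewrite /pl_loop mulr0 polygon0.
- by rewrite /pl_loop mulr1 polygonL.
Qed.

(** The classical contiguity relation, for simplicial maps from a subdivided line. *)
Definition contiguous w w' := forall i, exists2 sg, sg \in K &
  [/\ vtx w i \in sg, vtx w i.+1 \in sg, vtx w' i \in sg & vtx w' i.+1 \in sg].

Lemma contiguous_homotopic w w' L : (0 < L)%N -> edge_loop w L -> edge_loop w' L ->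
  contiguous w w' -> loop_homotopic K (vert v0) (pl_loop w L) (pl_loop w' L).
Proof.
move=> L0 wl wl' ct; apply: straight_homotopy; [by []|exact: pl_loop_loop|exact: pl_loop_loop|].
move=> t ht; have [i iL hi] := grid_index01 L0 ht.
have [sg sgK [h1 h2 h3 h4]] := ct i; exists sg => // j.
case: wl => w0 _ _; case: wl' => w0' _ _.
rewrite /pl_loop (polygon_seg w0 iL hi) (polygon_seg w0' iL hi).
by split; apply: segment_supp.
Qed.

Lemma edge_loop_widen w L L' : (L <= L')%N -> edge_loop w L -> edge_loop w L'.
Proof. by move=> h [a b c]; split=> // i hi; apply: b; apply: leq_trans hi. Qed.

Lemma polygon_widen w L L' : (L <= L')%N -> edge_loop w L ->
  polygon w L = polygon w L'.
Proof.
move=> /subnK <- [_ wL _]; apply/funext => u.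
elim: (L' - L)%N => [|k IH] //; rewrite addSn polygonS -IH.
by rewrite !wL ?subrr ?scaler0 ?addr0 // ?leq_addl // leqW ?leq_addl.
Qed.

(** The second loop runs through the same polygon at the higher speed [L'] and then rests at the
    base point; the homotopy interpolates the two speeds linearly. *)
Lemma widen_homotopic w L L' : (0 < L)%N -> (L <= L')%N -> edge_loop w L ->
  loop_homotopic K (vert v0) (pl_loop w L) (pl_loop w L').
Proof.
move=> L0 LL wl; rewrite /pl_loop.
have LLR : L%:R <= L'%:R :> R by rewrite ler_nat.
have L0R : 0 <= L%:R :> R by rewrite ler0n.
exists (fun p => polygon w L' (((L'%:R - L%:R) * p.1 + L%:R) * p.2)); split.
  apply: continuous_subspaceT; apply: comp_cont (@polygon_cont w L').
  by move=> p; apply: cvgM; [apply: affine_cont; exact: fst_cont | exact: snd_cont].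
split=> [[s t] /= [/andP[s0 s1] /andP[t0 t1]]|].
  apply: polygon_real; [exact: leq_trans LL | exact: edge_loop_widen wl|].
  have h : 0 <= (L'%:R - L%:R) * s + L%:R <= L'%:R.
    have h1 : 0 <= (L'%:R - L%:R) * s :> R by rewrite mulr_ge0 // subr_ge0.
    have h2 : (L'%:R - L%:R) * s <= L'%:R - L%:R :> R by rewrite ler_piMr // subr_ge0.
    by apply/andP; split; lra.
  case/andP: h => h1 h2; rewrite mulr_ge0 //=; apply: le_trans h2.
  by rewrite ler_piMr.
split=> [t ht|s /andP[s0 s1]] /=.
  by rewrite mulr0 add0r mulr1 subrK (polygon_widen LL wl).
rewrite mulr0 polygon0 mulr1 -(polygon_widen LL wl) polygonL //.
have : 0 <= (L'%:R - L%:R) * s :> R by rewrite mulr_ge0 // subr_ge0.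
lra.
Qed.

(** A simplicial approximation point by point. Since the [N] coordinates add up to 1, one of them is
    at least [1/N], and the default [v0] is never reached on points of the standard simplex. *)
Definition main_vertex x : 'I_N := odflt v0 [pick i | N%:R^-1 <= x ord0 i].

Lemma N_gt0 : 0 < N%:R :> R.
Proof. by rewrite ltr0n; apply: leq_trans (ltn_ord v0). Qed.

Lemma main_vertexP x : simplex_pt x -> N%:R^-1 <= x ord0 (main_vertex x).
Proof.
move=> [x0 x1]; rewrite /main_vertex; case: pickP => //= H.
suff : \sum_i x ord0 i < 1 by rewrite x1 ltxx.
have -> : 1 = \sum_(i < N) N%:R^-1 :> R.
  by rewrite sumr_const card_ord -[X in X *+ _]mul1r -mulrnAr -mulr_natr mulVf ?mul1r // gt_eqF ?N_gt0.
apply: ltr_sum; first by apply/hasP; exists v0; rewrite ?mem_index_enum.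
by move=> i _; rewrite ltNge H.
Qed.

Lemma main_vertex_vert v : main_vertex (vert v) = v.
Proof.
have := main_vertexP (simplex_vert v); rewrite vertE.
case: eqP => // _; rewrite leNgt invr_gt0 N_gt0 //.
Qed.

Definition fine (g : R -> 'rV[R]_N) (M : nat) := forall s t, unitI s -> unitI t ->
  `|s - t| <= M%:R^-1 -> forall i, `|g s ord0 i - g t ord0 i| < N%:R^-1.

Lemma invn_lt (M0 M : nat) : (M0.+2 <= M)%N -> M%:R^-1 < M0.+1%:R^-1 :> R.
Proof.
move=> h; rewrite ltf_pV2 ?ltr_nat //; rewrite posrE ltr0n //.
exact: leq_trans h.
Qed.

Lemma loop_fine x0 g : is_loop K x0 g ->
  exists M0 : nat, forall M, (M0 <= M)%N -> fine g M.
Proof.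
move=> lg; have e0 : 0 < N%:R^-1 :> R by rewrite invr_gt0 N_gt0.
have [M0 H] := compact_uniform unitI_compact (clamp_loop_cont lg) e0.
(* Balls are open while [fine] admits distance exactly [1/M], so [1/M] must be strictly below the
   radius [1/(M0 + 1)]. *)
exists M0.+2 => M hM s t hs ht st i.
have := H M0 (leqnn _) s t hs _ i; rewrite !clamp_id //; apply.
by rewrite /ball /=; apply: le_lt_trans st _; exact: invn_lt.
Qed.

(** A coordinate of size at least [1/N] cannot drop to zero under a change smaller than [1/N]. *)
Lemma near_main x y : simplex_pt x -> (forall i, `|x ord0 i - y ord0 i| < N%:R^-1) ->
  y ord0 (main_vertex x) != 0.
Proof.
move=> px hxy; apply/eqP => y0; have := hxy (main_vertex x).
rewrite y0 subr0 ger0_norm; last exact: px.1.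
by rewrite ltNge main_vertexP.
Qed.

Lemma supp_simplex x : realization K x ->
  finset.finset (fun i => x ord0 i != 0) \in K.
Proof. by case=> _ [_]. Qed.

Definition node (M j : nat) : R := j%:R / M%:R.

Lemma nodeI M j : (0 < M)%N -> (j <= M)%N -> unitI (node M j).
Proof.
move=> M0 jM; apply/andP; split; first by rewrite divr_ge0 ?ler0n.
by rewrite ler_pdivrMr ?ltr0n // mul1r ler_nat.
Qed.

Lemma node0 M : node M 0 = 0. Proof. by rewrite /node mul0r. Qed.

Lemma nodeM M : (0 < M)%N -> node M M = 1.
Proof. by move=> M0; rewrite /node divff // pnatr_eq0 -lt0n. Qed.

Lemma node_near M i t : (0 < M)%N -> i%:R <= M%:R * t <= i.+1%:R ->
  `|node M i - t| <= M%:R^-1 /\ `|node M i.+1 - t| <= M%:R^-1.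
Proof.
move=> M0; have M0R : 0 < M%:R :> R by rewrite ltr0n.
rewrite -natr1 => /andP[h1 h2].
have Mn : M%:R * M%:R^-1 = 1 :> R by rewrite divff // gt_eqF.
have e j : j%:R / M%:R - t = (j%:R - M%:R * t) / M%:R :> R.
  by rewrite mulrBl [M%:R * t]mulrC mulfK // gt_eqF.
rewrite /node !e !normrM !(@ger0_norm _ M%:R^-1) ?invr_ge0 ?ler0n //.
by split; rewrite ler_piMl ?invr_ge0 ?ler0n // ler_norml -?natr1; apply/andP; split; lra.
Qed.

Definition sample (g : R -> 'rV[R]_N) M : seq 'I_N :=
  mkseq (fun j => main_vertex (g (node M j))) M.+1.

Lemma sampleE g M j : (j <= M)%N -> vtx (sample g M) j = main_vertex (g (node M j)).
Proof. by move=> h; rewrite /vtx nth_mkseq. Qed.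

Lemma sample_default g M j : (M < j)%N -> vtx (sample g M) j = v0.
Proof. by move=> h; rewrite /vtx nth_default // size_mkseq. Qed.

Lemma adjacent_sub (sg : {set 'I_N}) a b : sg \in K -> a \in sg -> b \in sg -> adjacent a b.
Proof.
move=> sgK ha hb; apply: (scK.2 _ _ sgK).
  by apply/fintype.subsetP => i; rewrite !inE => /orP[] /eqP ->.
by apply/finset.set0Pn; exists a; rewrite !inE eqxx.
Qed.

Lemma realization_vert v : realization K (vert v) -> finset.set1 v \in K.
Proof.
move=> /supp_simplex; congr (_ \in K); apply/finset.setP => i.
by rewrite !inE vertE pnatr_eq0 eqb0 negbK.
Qed.

Lemma fine_main g M t j : (0 < M)%N -> is_loop K (vert v0) g -> fine g M -> unitI t ->
  (j <= M)%N -> `|node M j - t| <= M%:R^-1 ->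
  g t ord0 (main_vertex (g (node M j))) != 0.
Proof.
move=> M0 lg fg ht jM h; have hn := nodeI M0 jM.
apply: near_main; first by apply: realization_pt; exact: lg.2.1.
exact: fg.
Qed.

(** Two consecutive main vertices both lie in the support of [g] at the earlier node, which is a
    simplex; from the last node on, the sample rests at [v0]. *)
Lemma sample_edge_loop g M : (0 < M)%N -> is_loop K (vert v0) g -> fine g M ->
  edge_loop (sample g M) M.
Proof.
move=> M0 lg fg; have [_ [gr [g0 g1]]] := lg.
have sM : forall i, (M <= i)%N -> vtx (sample g M) i = v0.
  move=> i; rewrite leq_eqVlt => /orP[/eqP <-|h]; last exact: sample_default.
  by rewrite sampleE // nodeM // g1 main_vertex_vert.
split=> // [|i]; first by rewrite sampleE // node0 g0 main_vertex_vert.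
have [h|h] := leqP M i.
  rewrite !sM // 1?leqW // /adjacent finset.setUid; apply: realization_vert.
  by rewrite -g0; apply: gr; rewrite /unitI /= lexx ler01.
have [h1 h2] : `|node M i - node M i| <= M%:R^-1 /\
    `|node M i.+1 - node M i| <= M%:R^-1.
  apply: node_near => //; rewrite /node mulrCA divff ?mulr1 ?lexx ?ler_nat ?leqnSn //.
  by rewrite pnatr_eq0 -lt0n.
have hn := nodeI M0 (ltnW h).
rewrite !sampleE // 1?ltnW //; apply: (adjacent_sub (supp_simplex (gr _ hn))); rewrite inE;
  by apply: fine_main => //; exact: ltnW.
Qed.

(** The two sampled vertices around time [t] lie in the support of [g t], hence so does the point of
    the polygon between them. *)
Lemma sample_homotopic g M : (0 < M)%N -> is_loop K (vert v0) g -> fine g M ->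
  loop_homotopic K (vert v0) g (pl_loop (sample g M) M).
Proof.
move=> M0 lg fg; have el := sample_edge_loop M0 lg fg.
apply: straight_homotopy => //; first exact: pl_loop_loop.
move=> t ht; have gr := lg.2.1 _ ht.
exists (finset.finset (fun i => g t ord0 i != 0)); first exact: supp_simplex.
move=> i; split; first by rewrite inE.
have [k kM hk] := grid_index01 M0 ht; have [h1 h2] := node_near M0 hk.
rewrite /pl_loop (@polygon_seg _ k) //; last by case: el.
rewrite !sampleE // 1?ltnW //.
by apply: segment_supp; rewrite inE; apply: fine_main => //; exact: ltnW.
Qed.

End EdgeLoops.

(** * Degree of a loop *)

Section CocycleSums.
Variables (N : nat) (K : {set {set 'I_N}}) (v0 : 'I_N).
Hypothesis scK : is_simplicial_complex K.
Variables (A : zmodType) (c : 'I_N -> 'I_N -> A).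
Hypothesis cocycle : forall (sg : {set 'I_N}) a b d, sg \in K ->
  a \in sg -> b \in sg -> d \in sg -> c a d = c a b + c b d.
Implicit Types (s t u : R) (w : seq 'I_N) (W : nat -> 'I_N).

Definition walk_sum W n : A := \sum_(j < n) c (W j) (W j.+1).

Lemma cocycle_refl (sg : {set 'I_N}) a : sg \in K -> a \in sg -> c a a = 0.
Proof.
by move=> sgK ha; have /eqP := cocycle sgK ha ha ha; rewrite -[X in X == _]addr0 (inj_eq (addrI _)) eq_sym => /eqP.
Qed.

Lemma walk_sumS W n : walk_sum W n.+1 = walk_sum W n + c (W n) (W n.+1).
Proof. by rewrite /walk_sum big_ord_recr. Qed.

Lemma walk_sumD W n p : walk_sum W (n + p) = walk_sum W n + walk_sum (fun j => W (n + j)%N) p.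
Proof.
rewrite /walk_sum big_split_ord /=; congr (_ + _).
by apply: eq_bigr => j _; rewrite addnS.
Qed.

(** A discrete Stokes formula on a ladder: each square lies in one simplex, where the sum depends
    only on the end points, so inner rungs cancel and the two outer ones remain. *)
Lemma walk_sum_strip W W' n :
  (forall j, (j < n)%N -> exists2 sg, sg \in K &
     [/\ W j \in sg, W j.+1 \in sg, W' j \in sg & W' j.+1 \in sg]) ->
  walk_sum W n + c (W n) (W' n) = c (W 0) (W' 0) + walk_sum W' n.
Proof.
rewrite /walk_sum; elim: n => [|n IH] H; first by rewrite !big_ord0 add0r addr0.
rewrite !big_ord_recr /= addrA -IH; last by move=> j hj; apply: H; exact: ltnW.
have [sg sgK [h1 h2 h3 h4]] := H n (leqnn _).
by rewrite -!addrA -(cocycle sgK h1 h2 h4) -(cocycle sgK h1 h3 h4).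
Qed.

Lemma walk_sum_simplex (sg : {set 'I_N}) W n : sg \in K ->
  (forall r, (r <= n)%N -> W r \in sg) -> walk_sum W n = c (W 0) (W n).
Proof.
move=> sgK; rewrite /walk_sum; elim: n => [|n IH] H.
  by rewrite big_ord0 (cocycle_refl sgK) ?H.
rewrite big_ord_recr /= IH => [|r hr]; last by rewrite H // leqW.
by rewrite -(cocycle sgK) ?H.
Qed.

Lemma walk_sum_blocks W k n :
  (forall i, (i < n)%N -> exists2 sg, sg \in K &
     forall r, (r <= k)%N -> W (i * k + r)%N \in sg) ->
  walk_sum W (n * k) = walk_sum (fun i => W (i * k)%N) n.
Proof.
elim: n => [|n IH] H; first by rewrite mul0n /walk_sum !big_ord0.
rewrite mulSn addnC walk_sumD IH; last by move=> i hi; apply: H; exact: ltnW.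
rewrite [RHS]/walk_sum big_ord_recr /=; congr (_ + _).
have [sg sgK hs] := H n (leqnn _).
by rewrite (walk_sum_simplex sgK hs) addn0 mulSn addnC.
Qed.

Definition winding (g : R -> 'rV[R]_N) M : A :=
  walk_sum (fun j => main_vertex v0 (g (node M j))) M.

Lemma node_mul M k i : (0 < k)%N -> node (M * k) (i * k) = node M i.
Proof.
by move=> k0; rewrite /node !natrM -mulf_div divff ?mulr1 // pnatr_eq0 -lt0n.
Qed.

(** All nodes of the refined grid within one coarse step have their main vertices in the support of
    [g] at the start of that step, so the block contributes as a single edge. *)
Lemma winding_refine g M k : (0 < M)%N -> (0 < k)%N -> is_loop K (vert v0) g ->
  fine g M -> winding g (M * k) = winding g M.
Proof.
move=> M0 k0 lg fg; rewrite /winding walk_sum_blocks => [|i iM].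
  by apply: eq_bigr => j _; rewrite !node_mul.
have hn := nodeI M0 (ltnW iM); have gr := lg.2.1 _ hn.
have Mk0 : (0 < M * k)%N by rewrite muln_gt0 M0.
exists (finset.finset (fun j => g (node M i) ord0 j != 0)); first exact: supp_simplex.
move=> r rk; rewrite inE.
have hn' : unitI (node (M * k) (i * k + r)).
  apply: nodeI => //; apply: leq_trans (_ : i.+1 * k <= _)%N.
    by rewrite mulSn addnC leq_add2r.
  by rewrite leq_mul2r iM orbT.
apply: near_main; first by apply: realization_pt; exact: lg.2.1.
apply: fg => //; rewrite -(@node_mul M k i) // /node -mulrBl natrD addrAC subrr add0r.
rewrite ger0_norm ?divr_ge0 ?ler0n // natrM invfM mulrCA ler_piMr ?invr_ge0 ?ler0n //.
by rewrite ler_pdivrMr ?ltr0n // mul1r ler_nat.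
Qed.

(** Two grid sizes are compared through their common refinement [M * M']. *)
Lemma winding_stable g : is_loop K (vert v0) g ->
  exists M0 : nat, forall M M', (M0 <= M)%N -> (M0 <= M')%N -> winding g M = winding g M'.
Proof.
move=> lg; have [M0 H] := loop_fine v0 lg; exists M0.+1 => M M' h h'.
have p : (0 < M)%N by apply: leq_trans h.
have p' : (0 < M')%N by apply: leq_trans h'.
rewrite -(winding_refine p p' lg); last by apply: H; exact: ltnW.
by rewrite mulnC (winding_refine p' p lg) //; apply: H; exact: ltnW.
Qed.

Lemma cocycle_v0 g : is_loop K (vert v0) g -> c v0 v0 = 0.
Proof.
move=> [_ [gr [g0 _]]]; have : realization K (vert v0).
  by rewrite -g0; apply: gr; rewrite /unitI /= lexx ler01.
by move/realization_vert => h; apply: (cocycle_refl h); rewrite inE.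
Qed.

Lemma winding_homotopic a b : is_loop K (vert v0) a -> is_loop K (vert v0) b ->
  loop_homotopic K (vert v0) a b ->
  exists M0 : nat, forall M, (M0 <= M)%N -> winding a M = winding b M.
Proof.
move=> la lb [H [cH [rH [eH bH]]]].
pose r (p : R * R) := (clamp p.1, clamp p.2).
have cr : continuous r.
  by apply: pair_cont; [exact: (comp_cont fst_cont clamp_cont)|exact: (comp_cont snd_cont clamp_cont)].
have rI p : unitSq (r p) by split; exact: clampI.
have e0 : 0 < N%:R^-1 :> R by rewrite invr_gt0 (N_gt0 v0).
have [M0 HM] := compact_uniform unitSq_compact (within_comp cH cr rI) e0.
exists M0.+2 => M hM; have Mp : (0 < M)%N by apply: leq_trans hM.
have c00 := cocycle_v0 la.
pose W i j := main_vertex v0 (H (node M i, node M j)).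
(* Balls in the product are products of balls, so diagonal neighbours are near as well: the main
   vertices at all four corners of a grid square lie in the support at one corner. *)
have HW i j i' j' : (i <= M)%N -> (j <= M)%N -> (i' <= M)%N -> (j' <= M)%N ->
    `|node M i - node M i'| <= M%:R^-1 -> `|node M j - node M j'| <= M%:R^-1 ->
    H (node M i, node M j) ord0 (W i' j') != 0.
  move=> hi hj hi' hj' di dj.
  have I1 := nodeI Mp hi; have I2 := nodeI Mp hj.
  have I3 := nodeI Mp hi'; have I4 := nodeI Mp hj'.
  apply: near_main; first by apply: realization_pt; exact: rH.
  have := HM M0 (leqnn _) (node M i', node M j') (node M i, node M j).
  rewrite /r /= !clamp_id //; apply; first by split.
  have lt := invn_lt hM.
  by split; rewrite /ball /= distrC; exact: le_lt_trans lt.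
have dS i : `|node M i - node M i.+1| <= M%:R^-1.
  rewrite /node -mulrBl -natr1 opprD addrA subrr add0r mulN1r normrN ger0_norm //.
have d0 i : `|node M i - node M i| <= M%:R^-1 by rewrite subrr normr0 invr_ge0 ler0n.
(* The end rungs contribute [c v0 v0 = 0], because the homotopy is constant on the two vertical
   sides. *)
have row i : (i < M)%N -> walk_sum (W i) M = walk_sum (W i.+1) M.
  move=> iM; have := @walk_sum_strip (W i) (W i.+1) M.
  have [h1 h2] := bH _ (nodeI Mp (ltnW iM)); have [h3 h4] := bH _ (nodeI Mp iM).
  rewrite /W node0 nodeM // h1 h2 h3 h4 !main_vertex_vert c00 addr0 add0r; apply.
  move=> j jM; exists (finset.finset (fun l => H (node M i, node M j) ord0 l != 0)).
    by apply: supp_simplex; apply: rH; split; apply: nodeI => //; exact: ltnW.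
  by split; rewrite inE; apply: HW => //; exact: ltnW.
have : walk_sum (W 0) M = walk_sum (W M) M.
  have : forall i, (i <= M)%N -> walk_sum (W 0) M = walk_sum (W i) M.
    by elim=> // i IH hi; rewrite -row // IH // ltnW.
  exact.
have Wa j : (j <= M)%N -> W 0 j = main_vertex v0 (a (node M j)).
  by move=> hj; rewrite /W node0; case: (eH _ (nodeI Mp hj)) => ->.
have Wb j : (j <= M)%N -> W M j = main_vertex v0 (b (node M j)).
  by move=> hj; rewrite /W nodeM //; case: (eH _ (nodeI Mp hj)) => _ ->.
rewrite /winding /walk_sum => E.
transitivity (\sum_(j < M) c (W 0 j) (W 0 j.+1)).
  by apply: eq_bigr => j _; rewrite !Wa // ltnW.
by rewrite E; apply: eq_bigr => j _; rewrite !Wb // ltnW.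
Qed.

Lemma winding_concat a b M : (0 < M)%N -> is_loop K (vert v0) a ->
  is_loop K (vert v0) b ->
  winding (loop_concat a b) (M + M) = winding a M + winding b M.
Proof.
move=> M0 [_ [_ [_ a1]]] [_ [_ [b0 _]]].
have M0R : 0 < M%:R :> R by rewrite ltr0n.
have Mn : M%:R * M%:R^-1 = 1 :> R by rewrite divff // gt_eqF.
have e j : 2 * node (M + M) j = node M j.
  have -> : node M j = 2 * (j%:R / (2 * M%:R)) by rewrite /node; field; rewrite gt_eqF.
  rewrite /node natrD; congr (_ * (_ / _)); lra.
have l j : (j <= M)%N -> loop_concat a b (node (M + M) j) = a (node M j).
  move=> hj; rewrite /loop_concat e ifT //.
  have : node M j <= 1 by case/andP: (nodeI M0 hj).
  by rewrite -e; lra.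
have r j : loop_concat a b (node (M + M) (M + j)) = b (node M j).
  (* At the midpoint [loop_concat] is still given by [a], so the first node of [b] rests on
     [a 1 = b 0]. *)
  have [->|j0] := posnP j.
    by rewrite addn0 l // nodeM // a1 node0 b0.
  have h : node M (M + j) = 1 + node M j by rewrite /node natrD mulrDl Mn.
  rewrite /loop_concat e h ifF; first by congr b; lra.
  apply/negbTE; rewrite -ltNge.
  have : 0 < node M j by rewrite divr_gt0 ?ltr0n.
  have := e (M + j)%N; rewrite h; lra.
rewrite /winding walk_sumD; congr (_ + _); apply: eq_bigr => j _.
  by rewrite !l // ltnW.
by rewrite !r.
Qed.

(** On the grid [L * k] every [k]-th node hits a vertex of the polygon exactly, and the nodes in
    between have an end of the current edge as main vertex. *)
Lemma winding_pl_loop w L k : (0 < L)%N -> (0 < k)%N -> edge_loop K v0 w L ->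
  winding (pl_loop v0 w L) (L * k) = walk_sum (vtx v0 w) L.
Proof.
move=> L0 k0 wl; have [w0 wL wadj] := wl.
have L0R : 0 < L%:R :> R by rewrite ltr0n.
have k0R : 0 < k%:R :> R by rewrite ltr0n.
have val j : (L%:R : R) * node (L * k) j = j%:R / k%:R.
  by rewrite /node natrM; field; rewrite !gt_eqF.
rewrite /winding walk_sum_blocks => [|i iL].
  apply: eq_bigr => j _.
  have E i : (i <= L)%N -> main_vertex v0 (pl_loop v0 w L (node (L * k) (i * k))) = vtx v0 w i.
    move=> iL; rewrite /pl_loop val natrM mulfK ?gt_eqF //.
    by rewrite (polygon_cut _ _ iL) // polygon_full // main_vertex_vert.
  by rewrite !E // ltnW.
exists (finset.setU (finset.set1 (vtx v0 w i)) (finset.set1 (vtx v0 w i.+1))); first exact: wadj.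
move=> r rk; rewrite /pl_loop val.
have h : i%:R <= ((i * k + r)%:R / k%:R : R) <= i.+1%:R.
  rewrite ler_pdivlMr // ler_pdivrMr // -!natrM !ler_nat leq_addr /=.
  by rewrite mulSn addnC leq_add2r.
rewrite (polygon_seg w0 iL h).
apply: (@segment_supp _ _ (vtx v0 w i) (vtx v0 w i.+1)
  ((i * k + r)%:R / k%:R - i%:R)); rewrite ?inE ?eqxx ?orbT //.
set f := (i * k + r)%:R / k%:R - i%:R.
suff: N%:R^-1 <= ((1 - f) *: vert (vtx v0 w i) + f *: vert (vtx v0 w i.+1)) ord0
    (main_vertex v0 ((1 - f) *: vert (vtx v0 w i) + f *: vert (vtx v0 w i.+1))).
  by move=> hh; rewrite gt_eqF //; apply: (lt_le_trans _ hh); rewrite invr_gt0 (N_gt0 v0).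
apply: main_vertexP; apply: simplex_mix; try exact: simplex_vert.
by move: h; rewrite /f -natr1 => /andP[? ?]; apply/andP; split; lra.
Qed.

End CocycleSums.

(** * Edge-path equivalence *)

Section EdgePathEquivalence.
Variables (T : Type) (tri : T -> T -> T -> Prop).

(** Edge-path equivalence: a vertex is cut off across a triangle, or a pause is dropped. When [tri]
    holds for repeated vertices, [eqv_tri] also covers backtracking. *)
Inductive eqv : seq T -> seq T -> Prop :=
| eqv_tri l a b d r : tri a b d -> eqv (l ++ [:: a, b, d & r]) (l ++ [:: a, d & r])
| eqv_dup l a r : tri a a a -> eqv (l ++ [:: a, a & r]) (l ++ a :: r)
| eqv_refl w : eqv w w
| eqv_sym w w' : eqv w w' -> eqv w' w
| eqv_trans w w' w'' : eqv w w' -> eqv w' w'' -> eqv w w''.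

Lemma eqv_cat l w w' r : eqv w w' -> eqv (l ++ w ++ r) (l ++ w' ++ r).
Proof.
move=> e; elim: e => {w w'} [l' a b d r' h|l' a r' h|w|w w' _|w w' w'' _ h1 _ h2].
- by rewrite -!catA /= !catA; exact: eqv_tri.
- by rewrite -!catA /= !catA; exact: eqv_dup.
- exact: eqv_refl.
- exact: eqv_sym.
- exact: eqv_trans h1 h2.
Qed.

Lemma eqv_catl l w w' : eqv w w' -> eqv (l ++ w) (l ++ w').
Proof. by move=> /(eqv_cat l [::]); rewrite !cats0. Qed.

Lemma eqv_catr w w' r : eqv w w' -> eqv (w ++ r) (w' ++ r).
Proof. exact: eqv_cat [::] w w' r. Qed.

End EdgePathEquivalence.

Lemma eqv_map (T T' : Type) (tri : T -> T -> T -> Prop) (tri' : T' -> T' -> T' -> Prop)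
    (f : T -> T') : (forall a b d, tri a b d -> tri' (f a) (f b) (f d)) ->
  forall w w', eqv tri w w' -> eqv tri' (map f w) (map f w').
Proof.
move=> ff w w' e; elim: e => {w w'} [l a b d r h|l a r h|w|w w' _|w w' w'' _ h1 _ h2].
- by rewrite !map_cat /=; apply: eqv_tri; exact: ff.
- by rewrite !map_cat /=; apply: eqv_dup; exact: ff.
- exact: eqv_refl.
- exact: eqv_sym.
- exact: eqv_trans h1 h2.
Qed.

(** The head of an empty tail is [v0], so the last summand closes the path up at [v0]. *)
Fixpoint csum (T : Type) (A : zmodType) (c : T -> T -> A) (v0 : T) (w : seq T) : A :=
  if w is a :: s then c a (head v0 s) + csum c v0 s else 0.

Definition closed_path (T : eqType) (e : rel T) (v0 : T) (w : seq T) : bool :=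
  if w is a :: s then [&& a == v0, last a s == v0 & path e a s] else false.

Definition cosimplicial (N : nat) (K : {set {set 'I_N}}) (a b d : 'I_N) : Prop :=
  exists2 sg, sg \in K & [/\ a \in sg, b \in sg & d \in sg].

(** * A combinatorial criterion: from edge paths to the fundamental group *)

Section Criterion.
Variables (N : nat) (K : {set {set 'I_N}}) (v0 : 'I_N).
Hypothesis scK : is_simplicial_complex K.
Hypothesis v0K : finset.set1 v0 \in K.
Implicit Types (w l r : seq 'I_N).

Let adj_chain w := forall i, adjacent K (vtx v0 w i) (vtx v0 w i.+1).

Lemma closed_path_edge_loop w L : closed_path (adjacent K) v0 w ->
  (size w <= L)%N -> edge_loop K v0 w L.
Proof.
case: w => // a s /and3P[/eqP -> /eqP ls ps] hL; split=> // i.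
  by move=> hi; rewrite /vtx nth_default //; exact: leq_trans hi.
have v0v0 : adjacent K v0 v0 by rewrite /adjacent finset.setUid.
have [h|h] := ltnP i (size s); first by rewrite /vtx; exact: (pathP v0 ps).
have h' : vtx v0 (v0 :: s) i.+1 = v0 by rewrite /vtx nth_default.
move: h; rewrite h' leq_eqVlt => /orP[/eqP <-|h].
  by rewrite /vtx -last_nth ls.
by rewrite /vtx nth_default.
Qed.

Lemma closed_path_sample g M : (0 < M)%N -> is_loop K (vert v0) g -> fine g M ->
  closed_path (adjacent K) v0 (sample v0 g M).
Proof.
move=> M0 lg fg; have [s0 sM sadj] := sample_edge_loop scK M0 lg fg.
have : size (sample v0 g M) = M.+1 by rewrite size_mkseq.
case: (sample v0 g M) s0 (sM M (leqnn _)) sadj => //= a s -> + sadj [ss].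
rewrite /vtx -ss -last_nth => ->.
rewrite !eqxx /=; apply/(pathP v0) => i _.
exact: sadj i.
Qed.

(** A move takes place inside one simplex, whose vertices are pairwise adjacent, so it neither
    breaks nor repairs a path. *)
Lemma closed_path_eqv w w' : eqv (cosimplicial K) w w' ->
  closed_path (adjacent K) v0 w = closed_path (adjacent K) v0 w'.
Proof.
move=> e; elim: e => {w w'} [l a b d r [sg sgK [ha hb hd]]|l a r [sg sgK [ha _ _]]|//|//|w w' w'' _ -> _ ->//];
  last first.
  have haa := adjacent_sub scK sgK ha ha.
  case: l => [|x l] /=; first by rewrite haa.
  by rewrite !last_cat !cat_path /= haa.
have hab := adjacent_sub scK sgK ha hb; have hbd := adjacent_sub scK sgK hb hd.
have had := adjacent_sub scK sgK ha hd.
case: l => [|x l] /=; first by rewrite hab hbd had.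
by rewrite !last_cat !cat_path /= hab hbd had.
Qed.

Lemma adj_chain_behead x w : adj_chain (x :: w) -> adj_chain w.
Proof. by move=> h i; have := h i.+1. Qed.

Lemma contiguous_sym w w' : contiguous K v0 w w' -> contiguous K v0 w' w.
Proof. by move=> h i; have [sg sgK [? ? ? ?]] := h i; exists sg. Qed.

Lemma adjacentP a b : adjacent K a b -> exists2 sg, sg \in K & a \in sg /\ b \in sg.
Proof. by move=> h; exists (finset.setU (finset.set1 a) (finset.set1 b)); rewrite // !inE !eqxx orbT. Qed.

Lemma contiguous_cat l w w' : adj_chain (l ++ w) -> head v0 w = head v0 w' ->
  contiguous K v0 w w' -> contiguous K v0 (l ++ w) (l ++ w').
Proof.
move=> + hh ct; elim: l => [|x l IH] // hc.
have hd : vtx v0 (l ++ w') 0 = vtx v0 (l ++ w) 0.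
  by case: (l) => [|y l'] //; rewrite /vtx !nth0.
case=> [|i]; last by have := IH (adj_chain_behead hc) i.
have [sg sgK [h1 h2]] := adjacentP (hc 0%N).
by exists sg => //; split => //; rewrite -[vtx _ (_ :: _) 1]/(vtx v0 (l ++ w') 0) hd.
Qed.

(** Deleting [b] would shift all later positions and spoil contiguity; replacing it by a pause at
    [a] keeps them aligned. *)
Lemma contiguous_tri a b d r : adj_chain (d :: r) -> cosimplicial K a b d ->
  contiguous K v0 [:: a, b, d & r] [:: a, a, d & r].
Proof.
move=> hc [sg sgK [ha hb hd]] [|[|i]]; [by exists sg|by exists sg|].
by have [sg' sgK' [h1 h2]] := adjacentP (hc i); exists sg'.
Qed.

(** Equivalent lists may differ in length, so they are compared at every common length that is large
    enough. *)
Definition eventually_homotopic w w' := exists L0 : nat, forall L, (L0 <= L)%N ->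
  loop_homotopic K (vert v0) (pl_loop v0 w L) (pl_loop v0 w' L).

Lemma eventually_homotopic_trans w w' w'' : closed_path (adjacent K) v0 w' ->
  eventually_homotopic w w' -> eventually_homotopic w' w'' ->
  eventually_homotopic w w''.
Proof.
move=> cw' [L1 H1] [L2 H2]; exists (L1 + L2 + size w').+1 => L hL.
apply: (@homotopic_trans _ _ _ _ (pl_loop v0 w' L)).
- apply: pl_loop_loop => //; first by apply: leq_trans hL.
  by apply: closed_path_edge_loop => //; lia.
- by apply: H1; lia.
- by apply: H2; lia.
Qed.

Lemma eventually_homotopic_contiguous w w' : closed_path (adjacent K) v0 w ->
  closed_path (adjacent K) v0 w' -> contiguous K v0 w w' -> eventually_homotopic w w'.
Proof.
move=> cw cw' ct; exists (size w + size w').+1 => L hL.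
apply: contiguous_homotopic => //; first by apply: leq_trans hL.
  by apply: closed_path_edge_loop => //; lia.
by apply: closed_path_edge_loop => //; lia.
Qed.

Lemma adj_chain_closed w : closed_path (adjacent K) v0 w -> adj_chain w.
Proof. by move=> cw; case: (closed_path_edge_loop cw (leqnn _)). Qed.

Lemma adj_chain_drop l w : adj_chain (l ++ w) -> adj_chain w.
Proof. by elim: l => // x l IH /adj_chain_behead/IH. Qed.

Lemma cosimplicial_adj a b : adjacent K a b -> cosimplicial K a b b.
Proof. by move=> /adjacentP[sg sgK []]; exists sg. Qed.

(* The repeated vertex is moved to the end of the list, where it agrees with the padding. *)
Lemma eventually_homotopic_stutter l a r :
  closed_path (adjacent K) v0 (l ++ [:: a, a & r]) ->
  eventually_homotopic (l ++ [:: a, a & r]) (l ++ a :: r).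
Proof.
elim: r l a => [|b r IH] l a cw.
  have av0 : a = v0.
    by case: l cw => [|x l] /= /and3P[_ /eqP <- _] //; rewrite last_cat.
  rewrite av0 in cw *.
  exists (size (l ++ [:: v0; v0])).+1 => L hL.
  have E : vtx v0 (l ++ [:: v0; v0]) = vtx v0 (l ++ [:: v0]).
    apply/funext => i; rewrite /vtx !nth_cat; case: ifP => // _.
    by case: (i - size l)%N => [|[|j]] //=; rewrite nth_nil.
  have <- : pl_loop v0 (l ++ [:: v0; v0]) L = pl_loop v0 (l ++ [:: v0]) L.
    by apply/funext => t; rewrite /pl_loop /polygon E.
  apply: homotopic_refl => //; apply: pl_loop_loop => //; first by apply: leq_trans hL.
  by apply: closed_path_edge_loop => //; exact: ltnW.
have hc := adj_chain_drop (adj_chain_closed cw).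
have hab : adjacent K a b := hc 1%N.
have e : eqv (cosimplicial K) (l ++ [:: a, b, b & r]) (l ++ [:: a, a, b & r]).
  apply: eqv_trans (eqv_tri _ _ (cosimplicial_adj hab)) _.
  apply: eqv_sym; apply: eqv_tri.
  by have [sg sgK []] := adjacentP hab; exists sg.
have cw' : closed_path (adjacent K) v0 (l ++ [:: a, b, b & r]).
  by rewrite (closed_path_eqv e).
apply: (eventually_homotopic_trans cw').
  apply: eventually_homotopic_contiguous => //; apply: contiguous_sym.
  apply: contiguous_cat => //; first exact: adj_chain_closed.
  apply: contiguous_tri (cosimplicial_adj hab).
  by apply: adj_chain_behead; apply: adj_chain_behead; exact: hc.
by have := IH (rcons l a) b; rewrite !cat_rcons; apply.
Qed.

(** A triangle move is split in two: a contiguity onto the path that pauses at [a], then the removal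
    of the pause. *)
Lemma eqv_homotopic w w' : eqv (cosimplicial K) w w' ->
  closed_path (adjacent K) v0 w -> eventually_homotopic w w'.
Proof.
move=> e; elim: e => {w w'} [l a b d r h|l a r _|w|w w' e IH|w w' w'' e1 h1 e2 h2] cw.
- have e : eqv (cosimplicial K) (l ++ [:: a, b, d & r]) (l ++ [:: a, a, d & r]).
    apply: eqv_trans (eqv_tri _ _ h) _; apply: eqv_sym; apply: eqv_tri.
    by have [sg sgK [ha hb hd]] := h; exists sg.
  have cw' : closed_path (adjacent K) v0 (l ++ [:: a, a, d & r]).
    by rewrite -(closed_path_eqv e).
  apply: (eventually_homotopic_trans cw'); last exact: eventually_homotopic_stutter.
  apply: eventually_homotopic_contiguous => //; apply: contiguous_cat => //.
    exact: adj_chain_closed.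
  apply: contiguous_tri h; have := adj_chain_drop (adj_chain_closed cw).
  by move/adj_chain_behead/adj_chain_behead.
- exact: eventually_homotopic_stutter.
- exists (size w).+1 => L hL; apply: homotopic_refl => //; apply: pl_loop_loop => //.
    exact: leq_trans hL.
  by apply: closed_path_edge_loop => //; exact: ltnW.
- have [|L0 H] := IH; first by rewrite (closed_path_eqv e).
  by exists L0 => L hL; apply: homotopic_sym; exact: H.
- have cw' : closed_path (adjacent K) v0 w' by rewrite -(closed_path_eqv e1).
  exact: (eventually_homotopic_trans cw' (h1 cw) (h2 cw')).
Qed.

Variables (m : nat) (c : 'I_N -> 'I_N -> 'rV[int]_m).
Hypothesis cocycle : forall (sg : {set 'I_N}) a b d, sg \in K ->
  a \in sg -> b \in sg -> d \in sg -> c a d = c a b + c b d.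

Lemma csum_walk w : csum c v0 w = walk_sum c (vtx v0 w) (size w).
Proof.
elim: w => [|a w IH] /=; first by rewrite /walk_sum big_ord0.
by rewrite /walk_sum big_ord_recl /= IH -nth0.
Qed.

Lemma csum_sample g M : (0 < M)%N -> is_loop K (vert v0) g ->
  csum c v0 (sample v0 g M) = winding v0 c g M.
Proof.
move=> M0 lg; rewrite csum_walk size_mkseq walk_sumS.
rewrite sampleE // sample_default // nodeM // lg.2.2.2 main_vertex_vert.
rewrite (cocycle_refl cocycle v0K) ?inE // addr0.
by apply: eq_bigr => j _; rewrite !sampleE // ltnW.
Qed.

Hypothesis inj_csum : forall w w', closed_path (adjacent K) v0 w ->
  closed_path (adjacent K) v0 w' -> csum c v0 w = csum c v0 w' ->
  eqv (cosimplicial K) w w'.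
Hypothesis surj_csum : forall z, exists2 w, closed_path (adjacent K) v0 w & csum c v0 w = z.

(** The eventual value of the winding sums as the grid gets finer; [0] is the default for functions
    without such a value. *)
Definition degree (g : R -> 'rV[R]_N) : 'rV[int]_m :=
  xget 0 [set z | exists M0 : nat, forall M, (M0 <= M)%N -> winding v0 c g M = z].

Lemma degreeP g : is_loop K (vert v0) g ->
  exists M0 : nat, forall M, (M0 <= M)%N -> winding v0 c g M = degree g.
Proof.
move=> lg; have [M0 H] := winding_stable cocycle lg.
rewrite /degree; case: xgetP => [z _ //|/(_ (winding v0 c g M0)) []].
by exists M0 => M hM; apply: H.
Qed.

Theorem pi1_iso_of_edge_paths : pi1_iso_Zpow K (vert v0) m.
Proof.
exists degree; split=> [a b la lb|]; last split=> [z|a b la lb].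
- have [Ma Ha] := degreeP la; have [Mb Hb] := degreeP lb.
  split=> [E|hab]; last first.
    have [M0 H] := winding_homotopic cocycle la lb hab.
    have hM : (M0 <= Ma + Mb + M0)%N by lia.
    by rewrite -(Ha (Ma + Mb + M0)%N) ?(H _ hM) ?Hb //; lia.
  have [Fa HFa] := loop_fine v0 la; have [Fb HFb] := loop_fine v0 lb.
  (* One grid that computes both degrees and on which both samples are edge loops. *)
  pose M := (Ma + Mb + Fa + Fb).+1.
  have fa : fine a M by apply: HFa; rewrite /M; lia.
  have fb : fine b M by apply: HFb; rewrite /M; lia.
  have M0 : (0 < M)%N by [].
  have ca := closed_path_sample M0 la fa; have cb := closed_path_sample M0 lb fb.
  have e : eqv (cosimplicial K) (sample v0 a M) (sample v0 b M).
    by apply: inj_csum => //; rewrite !csum_sample // Ha ?Hb //; rewrite /M; lia.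
  have [L0 H] := eqv_homotopic e ca.
  (* The sampled polygon is widened to length [L0 + M], where the edge-path equivalence already
     yields a homotopy. *)
  have step g : is_loop K (vert v0) g -> fine g M ->
      loop_homotopic K (vert v0) g (pl_loop v0 (sample v0 g M) (L0 + M)).
    move=> lg fg; have el := sample_edge_loop scK M0 lg fg.
    apply: homotopic_trans (sample_homotopic scK M0 lg fg) _; first exact: pl_loop_loop.
    by apply: widen_homotopic => //; exact: leq_addl.
  have pl g : is_loop K (vert v0) g -> fine g M ->
      is_loop K (vert v0) (pl_loop v0 (sample v0 g M) (L0 + M)).
    move=> lg fg; apply: pl_loop_loop => //; first by rewrite addn_gt0 M0 orbT.
    exact: edge_loop_widen (leq_addl _ _) (sample_edge_loop scK M0 lg fg).
  apply: homotopic_trans (step a la fa) _; first exact: pl.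
  apply: homotopic_trans (homotopic_sym (step b lb fb)); first exact: pl.
  by apply: H; exact: leq_addr.
- have [w cw <-] := surj_csum z.
  have w0 : (0 < size w)%N by case: w cw.
  have el := closed_path_edge_loop cw (leqnn _).
  have lw := pl_loop_loop scK w0 el.
  exists (pl_loop v0 w (size w)); split=> //.
  have [M0 H] := degreeP lw.
  (* [winding_pl_loop] evaluates on multiples of the length, and the factor [M0.+1] makes this
     multiple large enough for [H]. *)
  rewrite -(H (size w * M0.+1)%N) ?(winding_pl_loop cocycle) ?csum_walk //.
  by apply: leq_trans (leqnSn _) _; rewrite leq_pmull.
- have [Ma Ha] := degreeP la; have [Mb Hb] := degreeP lb.
  have [Mc Hc] := degreeP (loop_concat_loop la lb).
  pose M := (Ma + Mb + Mc).+1.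
  have M0 : (0 < M)%N by [].
  rewrite -(Hc (M + M)%N); last by rewrite /M; lia.
  rewrite (winding_concat c M0 la lb) Ha; last by rewrite /M; lia.
  by rewrite Hb // /M; lia.
Qed.

End Criterion.

(** * Words in commuting letters *)

Section CommutingWords.
Variable m : nat.
Implicit Types (l : 'I_m * bool) (u v w : seq ('I_m * bool)) (z : 'rV[int]_m).
Variable weq : seq ('I_m * bool) -> seq ('I_m * bool) -> Prop.
Hypothesis weq_refl : forall w, weq w w.
Hypothesis weq_sym : forall w w', weq w w' -> weq w' w.
Hypothesis weq_trans : forall w w' w'', weq w w' -> weq w' w'' -> weq w w''.
Hypothesis weq_cat : forall u v w w', weq w w' -> weq (u ++ w ++ v) (u ++ w' ++ v).
Hypothesis weq_cancel : forall i b, weq [:: (i, b); (i, ~~ b)] [::].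
Hypothesis weq_comm : forall l l', l.1 != l'.1 -> weq [:: l; l'] [:: l'; l].

Definition basis (i : 'I_m) : 'rV[int]_m := delta_mx ord0 i.

Definition letter_exp l : 'rV[int]_m := if l.2 then basis l.1 else - basis l.1.

Definition word_exp w : 'rV[int]_m := \sum_(l <- w) letter_exp l.

Definition power_word (i : 'I_m) (n : int) := nseq `|n|%N (i, 0 <= n).

(** The monomial with exponents [z], its generators in the order of [r]. *)
Definition normal_word (r : seq 'I_m) z := flatten [seq power_word i (z ord0 i) | i <- r].

Lemma word_exp_cat u v : word_exp (u ++ v) = word_exp u + word_exp v.
Proof. exact: big_cat. Qed.

Lemma word_exp1 l : word_exp [:: l] = letter_exp l.
Proof. exact: big_seq1. Qed.

Lemma word_exp_nseq n l : word_exp (nseq n l) = letter_exp l *+ n.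
Proof.
elim: n => [|n IH] /=; first by rewrite /word_exp big_nil mulr0n.
by rewrite -cat1s word_exp_cat word_exp1 IH mulrS.
Qed.

Lemma power_word_exp i n : word_exp (power_word i n) = basis i *~ n.
Proof.
rewrite /power_word word_exp_nseq; case: n => n //=.
by rewrite /letter_exp /= NegzE mulrNz mulNrn.
Qed.

Lemma normal_word_exp z : word_exp (normal_word (enum 'I_m) z) = z.
Proof.
have -> : word_exp (normal_word (enum 'I_m) z) = \sum_i z ord0 i *: basis i.
  rewrite -big_enum /= /normal_word; elim: (enum _) => [|i r IH] /=.
    by rewrite /word_exp !big_nil.
  by rewrite word_exp_cat IH big_cons power_word_exp -scaler_int intz.
by rewrite [RHS]row_sum_delta.
Qed.

(** Letters over the same generator are equal or mutually inverse, and in the latter case both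
    products cancel. *)
Lemma weq_swap l l' : weq [:: l; l'] [:: l'; l].
Proof.
have [E|] := eqVneq l.1 l'.1; last exact: weq_comm.
case: l l' E => i b [j b'] /= <-.
case: (eqVneq b b') => [->//|nb].
have -> : b' = ~~ b by case: b b' nb => [] [].
apply: weq_trans (weq_cancel i b) _; apply: weq_sym.
by have := weq_cancel i (~~ b); rewrite negbK.
Qed.

Lemma weq_push w l : weq (rcons w l) (l :: w).
Proof.
elim: w => [|l' w IH] //=.
apply: weq_trans (_ : weq _ (l' :: l :: w)) _.
  by have := weq_cat [:: l'] [::] IH; rewrite !cats0.
by have := weq_cat [::] w (weq_swap l' l).
Qed.

Lemma weq_cancel_rcons w i b : weq (rcons (rcons w (i, b)) (i, ~~ b)) w.
Proof.
by have := weq_cat w [::] (weq_cancel i b); rewrite !cats0 -!cats1 -catA.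
Qed.

Lemma nseq_rcons (T : Type) n (x : T) : rcons (nseq n x) x = nseq n.+1 x.
Proof. by elim: n => //= n ->. Qed.

Lemma power_word_rcons i n b :
  weq (rcons (power_word i n) (i, b)) (power_word i (n + (if b then 1 else -1))).
Proof.
rewrite /power_word; case: n b => n [].
- by rewrite -PoszD addn1 nseq_rcons.
- case: n => [|n] //.
  have -> : n.+1%:Z + -1 = n%:Z by lia.
  by rewrite -nseq_rcons; exact: (weq_cancel_rcons _ i true).
(* [Negz n] is minus [n.+1], so one letter cancels; for [n = 0] the sign flips, but the word is then
   empty. *)
- have -> : `|(Negz n + 1)%R|%N = n by lia.
  rewrite -nseq_rcons; apply: weq_trans (weq_cancel_rcons _ i false) _.
  by case: n.
- have -> : `|(Negz n + -1)%R|%N = n.+2 by lia.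
  have -> : 0 <= Negz n + -1 = false by apply/negbTE; lia.
  by rewrite nseq_rcons.
Qed.

Lemma normal_word_notin r z z' : (forall i, i \in r -> z ord0 i = z' ord0 i) ->
  normal_word r z = normal_word r z'.
Proof. by move=> h; congr flatten; apply/eq_in_map => i hi; rewrite h. Qed.

(** The new letter travels left past the blocks of later generators and is absorbed by its own
    block. *)
Lemma normal_word_rcons r z l : uniq r -> l.1 \in r ->
  weq (rcons (normal_word r z) l) (normal_word r (z + letter_exp l)).
Proof.
case: l => i b /=; have E j : (z + letter_exp (i, b)) ord0 j =
    z ord0 j + (if j == i then if b then 1 else -1 else 0).
  rewrite mxE; congr (_ + _); rewrite /letter_exp /basis /=.
  by case: b; rewrite !mxE /=; case: (j == i); rewrite ?oppr0.
elim: r => //= h r IH /andP[hr ur]; rewrite inE.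
rewrite [normal_word (_ :: _) _]/(power_word _ _ ++ normal_word r _) rcons_cat.
rewrite [normal_word (_ :: _) _]/(power_word _ _ ++ normal_word r _) E eq_sym.
case: (eqVneq i h) hr => [<-|ni] hr /= => [_|ir].
  rewrite (@normal_word_notin r (z + _) z); last first.
    move=> j jr; rewrite E ifF ?addr0 //; apply/negP => /eqP ji.
    by move: hr; rewrite -ji jr.
  apply: weq_trans (_ : weq _ (power_word i (z ord0 i) ++ (i, b) :: normal_word r z)) _.
    by have := weq_cat (power_word i (z ord0 i)) [::] (weq_push (normal_word r z) (i, b)); rewrite !cats0.
  by have := weq_cat [::] (normal_word r z) (power_word_rcons i (z ord0 i) b); rewrite /= cat_rcons.
rewrite addr0.
by have := weq_cat (power_word h (z ord0 h)) [::] (IH ur ir); rewrite !cats0.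
Qed.

Lemma weq_normal w : weq w (normal_word (enum 'I_m) (word_exp w)).
Proof.
elim/last_ind: w => [|w l IH].
  have -> : word_exp [::] = 0 by rewrite /word_exp big_nil.
  have -> : normal_word (enum 'I_m) 0 = [::] by elim: (enum _) => //= i r; rewrite /normal_word /= mxE.
  exact: weq_refl.
apply: weq_trans (_ : weq _ (rcons (normal_word (enum 'I_m) (word_exp w)) l)) _.
  by have := weq_cat [::] [:: l] IH; rewrite /= !cats1.
rewrite -[rcons w l]cats1 word_exp_cat word_exp1.
by apply: normal_word_rcons; rewrite ?enum_uniq ?mem_enum.
Qed.

(** Both words reduce to the same monomial: cancellation and commutation present the free abelian
    group. *)
Lemma weq_of_exp w w' : word_exp w = word_exp w' -> weq w w'.
Proof.
move=> E; apply: weq_trans (weq_normal w) _; rewrite E; apply: weq_sym.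
exact: weq_normal.
Qed.

End CommutingWords.

(** * The seven-vertex torus *)

Local Close Scope classical_set_scope.

Section Torus.

(** The vertex-minimal torus of Möbius: 14 triangles, invariant under rotation modulo 7, in which
    any two vertices span an edge. *)
Definition torus_triangles : seq (seq nat) :=
  [seq [:: i; (i + 1) %% 7; (i + 3) %% 7]%N | i <- iota 0 7] ++
  [seq [:: i; (i + 2) %% 7; (i + 3) %% 7]%N | i <- iota 0 7].

Definition torus_tri (a b d : nat) : bool :=
  has (fun t => [&& a \in t, b \in t & d \in t]) torus_triangles.

(* The cocycles dual to the generators [0 2 4] and [0 6 5], normalised to vanish on the edges at [0]. *)
Definition torus_cocycle (a b : nat) : int * int :=
  match a, b with
  | 2, 4 | 2, 5 | 3, 5 => (1, 0)
  | 4, 2 | 5, 2 | 5, 3 => (-1, 0)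
  | 6, 5 | 6, 1 | 2, 1 => (0, 1)
  | 5, 6 | 1, 6 | 1, 2 => (0, -1)
  | 3, 6 | 3, 4 | 1, 4 => (1, -1)
  | 6, 3 | 4, 3 | 4, 1 => (-1, 1)
  | _, _ => (0, 0)
  end.

Definition torus_word (x : int * int) : seq (bool * bool) :=
  nseq `|x.1|%N (false, 0 <= x.1) ++ nseq `|x.2|%N (true, 0 <= x.2).

Definition torus_letter (l : bool * bool) : seq nat :=
  match l with
  | (false, true) => [:: 0; 2; 4] | (false, false) => [:: 0; 4; 2]
  | (true, true) => [:: 0; 6; 5] | (true, false) => [:: 0; 5; 6]
  end%N.

Definition torus_path (w : seq (bool * bool)) : seq nat := flatten (map torus_letter w).

(** A boolean test for one [eqv_tri] move in the deleting direction; [tri_chain] tries both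
    directions. *)
Fixpoint tri_step (w w' : seq nat) : bool :=
  match w, w' with
  | [:: a, b & w1], a' :: w1' => (a == a') &&
      ((if w1 is d :: _ then torus_tri a b d && (w1 == w1') else false)
       || tri_step (b :: w1) w1')
  | _, _ => false
  end.

Fixpoint tri_chain (w : seq nat) (ws : seq (seq nat)) : bool :=
  if ws is w' :: ws' then (tri_step w w' || tri_step w' w) && tri_chain w' ws' else true.

(** The table [cs] is only a source of certificates: a chain counts if its ends match and every step
    passes the test. *)
Definition has_chain (cs : seq (seq (seq nat))) (w w' : seq nat) : bool :=
  tri_step w w' || has (fun ws => if ws is w1 :: ws1 then
    [&& w1 == w, last w1 ws1 == w' & tri_chain w1 ws1] else false) cs.

(* Each chain is a sequence of elementary moves rewriting [0 a b] into a torus path followed by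
   [0 b], or a product of two generators into the product in the other order. *)
Definition torus_chains : seq (seq (seq nat)) := [::
  [:: [:: 0; 1; 2]; [:: 0; 5; 1; 2]; [:: 0; 5; 6; 1; 2]; [:: 0; 5; 6; 2]; [:: 0; 5; 6; 0; 2]];
  [:: [:: 0; 1; 4]; [:: 0; 3; 1; 4]; [:: 0; 3; 4]; [:: 0; 3; 6; 4]; [:: 0; 3; 5; 6; 4]; [:: 0; 3; 2; 5; 6; 4]; [:: 0; 2; 5; 6; 4]; [:: 0; 2; 5; 6; 0; 4]; [:: 0; 2; 4; 5; 6; 0; 4]; [:: 0; 2; 4; 0; 5; 6; 0; 4]];
  [:: [:: 0; 1; 6]; [:: 0; 5; 1; 6]; [:: 0; 5; 6]; [:: 0; 5; 6; 6]; [:: 0; 5; 6; 0; 6]];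
  [:: [:: 0; 2; 1]; [:: 0; 6; 2; 1]; [:: 0; 6; 1]; [:: 0; 6; 5; 1]; [:: 0; 6; 5; 0; 1]];
  [:: [:: 0; 2; 4]; [:: 0; 2; 4; 4]; [:: 0; 2; 4; 0; 4]];
  [:: [:: 0; 2; 5]; [:: 0; 2; 4; 5]; [:: 0; 2; 4; 0; 5]];
  [:: [:: 0; 3; 4]; [:: 0; 2; 3; 4]; [:: 0; 2; 5; 3; 4]; [:: 0; 2; 4; 5; 3; 4]; [:: 0; 2; 4; 5; 3; 6; 4]; [:: 0; 2; 4; 5; 6; 4]; [:: 0; 2; 4; 5; 6; 0; 4]; [:: 0; 2; 4; 0; 5; 6; 0; 4]];
  [:: [:: 0; 3; 5]; [:: 0; 2; 3; 5]; [:: 0; 2; 5]; [:: 0; 2; 4; 5]; [:: 0; 2; 4; 0; 5]];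
  [:: [:: 0; 3; 6]; [:: 0; 2; 3; 6]; [:: 0; 2; 5; 3; 6]; [:: 0; 2; 5; 6]; [:: 0; 2; 5; 6; 6]; [:: 0; 2; 5; 6; 0; 6]; [:: 0; 2; 4; 5; 6; 0; 6]; [:: 0; 2; 4; 0; 5; 6; 0; 6]];
  [:: [:: 0; 4; 1]; [:: 0; 4; 2; 1]; [:: 0; 4; 2; 6; 1]; [:: 0; 4; 2; 6; 5; 1]; [:: 0; 4; 2; 6; 5; 0; 1]; [:: 0; 4; 2; 0; 6; 5; 0; 1]];
  [:: [:: 0; 4; 2]; [:: 0; 4; 2; 2]; [:: 0; 4; 2; 0; 2]];
  [:: [:: 0; 4; 3]; [:: 0; 4; 1; 3]; [:: 0; 4; 2; 1; 3]; [:: 0; 4; 2; 6; 1; 3]; [:: 0; 4; 2; 6; 1; 0; 3]; [:: 0; 4; 2; 6; 1; 5; 0; 3]; [:: 0; 4; 2; 6; 5; 0; 3]; [:: 0; 4; 2; 0; 6; 5; 0; 3]];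
  [:: [:: 0; 5; 2]; [:: 0; 4; 5; 2]; [:: 0; 4; 2]; [:: 0; 4; 2; 2]; [:: 0; 4; 2; 0; 2]];
  [:: [:: 0; 5; 3]; [:: 0; 4; 5; 3]; [:: 0; 4; 2; 5; 3]; [:: 0; 4; 2; 3]; [:: 0; 4; 2; 0; 3]];
  [:: [:: 0; 5; 6]; [:: 0; 5; 6; 6]; [:: 0; 5; 6; 0; 6]];
  [:: [:: 0; 6; 1]; [:: 0; 6; 5; 1]; [:: 0; 6; 5; 0; 1]];
  [:: [:: 0; 6; 3]; [:: 0; 4; 6; 3]; [:: 0; 4; 3]; [:: 0; 4; 1; 3]; [:: 0; 4; 1; 0; 3]; [:: 0; 4; 1; 5; 0; 3]; [:: 0; 4; 1; 6; 5; 0; 3]; [:: 0; 4; 1; 2; 6; 5; 0; 3]; [:: 0; 4; 2; 6; 5; 0; 3]; [:: 0; 4; 2; 0; 6; 5; 0; 3]];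
  [:: [:: 0; 6; 5]; [:: 0; 6; 5; 5]; [:: 0; 6; 5; 0; 5]];
  [:: [:: 0; 2; 4; 0; 6; 5; 0]; [:: 0; 2; 4; 6; 5; 0]; [:: 0; 2; 4; 3; 6; 5; 0]; [:: 0; 2; 4; 3; 5; 0]; [:: 0; 2; 4; 3; 5; 4; 0]; [:: 0; 2; 4; 3; 5; 2; 4; 0]; [:: 0; 2; 4; 3; 2; 4; 0]; [:: 0; 2; 4; 1; 3; 2; 4; 0]; [:: 0; 2; 1; 3; 2; 4; 0]; [:: 0; 2; 1; 3; 0; 2; 4; 0]; [:: 0; 2; 1; 0; 2; 4; 0]; [:: 0; 2; 6; 1; 0; 2; 4; 0]; [:: 0; 6; 1; 0; 2; 4; 0]; [:: 0; 6; 1; 5; 0; 2; 4; 0]; [:: 0; 6; 5; 0; 2; 4; 0]];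
  [:: [:: 0; 2; 4; 0; 5; 6; 0]; [:: 0; 2; 4; 5; 6; 0]; [:: 0; 2; 5; 6; 0]; [:: 0; 3; 2; 5; 6; 0]; [:: 0; 3; 5; 6; 0]; [:: 0; 3; 6; 0]; [:: 0; 1; 3; 6; 0]; [:: 0; 5; 1; 3; 6; 0]; [:: 0; 5; 1; 4; 3; 6; 0]; [:: 0; 5; 1; 4; 6; 0]; [:: 0; 5; 1; 4; 0]; [:: 0; 5; 1; 2; 4; 0]; [:: 0; 5; 1; 6; 2; 4; 0]; [:: 0; 5; 6; 2; 4; 0]; [:: 0; 5; 6; 0; 2; 4; 0]];
  [:: [:: 0; 4; 2; 0; 6; 5; 0]; [:: 0; 4; 2; 6; 5; 0]; [:: 0; 4; 1; 2; 6; 5; 0]; [:: 0; 4; 1; 6; 5; 0]; [:: 0; 4; 1; 5; 0]; [:: 0; 4; 1; 0]; [:: 0; 4; 1; 3; 0]; [:: 0; 4; 3; 0]; [:: 0; 4; 3; 2; 0]; [:: 0; 4; 3; 5; 2; 0]; [:: 0; 4; 3; 6; 5; 2; 0]; [:: 0; 4; 6; 5; 2; 0]; [:: 0; 6; 5; 2; 0]; [:: 0; 6; 5; 4; 2; 0]; [:: 0; 6; 5; 0; 4; 2; 0]];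
  [:: [:: 0; 4; 2; 0; 5; 6; 0]; [:: 0; 5; 4; 2; 0; 5; 6; 0]; [:: 0; 5; 2; 0; 5; 6; 0]; [:: 0; 5; 3; 2; 0; 5; 6; 0]; [:: 0; 5; 3; 0; 5; 6; 0]; [:: 0; 5; 3; 1; 0; 5; 6; 0]; [:: 0; 5; 3; 1; 5; 6; 0]; [:: 0; 5; 3; 1; 6; 0]; [:: 0; 5; 6; 3; 1; 6; 0]; [:: 0; 5; 6; 4; 3; 1; 6; 0]; [:: 0; 5; 6; 4; 1; 6; 0]; [:: 0; 5; 6; 4; 2; 1; 6; 0]; [:: 0; 5; 6; 4; 2; 6; 0]; [:: 0; 5; 6; 4; 2; 0]; [:: 0; 5; 6; 0; 4; 2; 0]]]%N.

Lemma tri_step_eqv w w' : tri_step w w' -> eqv torus_tri w w'.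
Proof.
elim: w w' => [|a [|b w] IH] //= [|a' w'] // /andP[/eqP <-] /orP[]; last first.
  by move=> h; have := eqv_catl [:: a] (IH w' h).
by case: w {IH} => [|d w] // /andP[h /eqP <-]; exact: (@eqv_tri _ _ [::]).
Qed.

Lemma tri_chain_eqv w ws : tri_chain w ws -> eqv torus_tri w (last w ws).
Proof.
elim: ws w => [|w' ws IH] w /=; first by move=> _; exact: eqv_refl.
move=> /andP[h /IH]; apply: eqv_trans; case/orP: h => /tri_step_eqv //.
exact: eqv_sym.
Qed.

Lemma has_chain_eqv cs w w' : has_chain cs w w' -> eqv torus_tri w w'.
Proof.
move=> /orP[/tri_step_eqv //|/hasP[[|w1 ws] // _ /and3P[/eqP <- /eqP <-]]].
exact: tri_chain_eqv.
Qed.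

(** This is what allows a path to be read edge by edge: an edge approached from [0] is traded for a
    word in the two generators. All 49 pairs are checked by computation. *)
Lemma torus_edge_eqv a b : (a < 7)%N -> (b < 7)%N ->
  eqv torus_tri [:: 0; a; b]%N (torus_path (torus_word (torus_cocycle a b)) ++ [:: 0; b]%N).
Proof.
move=> ha hb; apply: (@has_chain_eqv torus_chains).
have : all (fun a => all (fun b => has_chain torus_chains [:: 0; a; b]%N
    (torus_path (torus_word (torus_cocycle a b)) ++ [:: 0; b]%N)) (iota 0 7)) (iota 0 7).
  by vm_compute.
by move=> /allP/(_ a) h1; apply: (allP (h1 _)); rewrite mem_iota.
Qed.

Lemma torus_comm_eqv s t : eqv torus_tri
  (torus_path [:: (false, s); (true, t)] ++ [:: 0%N])
  (torus_path [:: (true, t); (false, s)] ++ [:: 0%N]).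
Proof. by apply: (@has_chain_eqv torus_chains); case: s t => [] []; vm_compute. Qed.

Lemma torus_cocycleP t a b d : t \in torus_triangles -> a \in t -> b \in t -> d \in t ->
  torus_cocycle a d =
  ((torus_cocycle a b).1 + (torus_cocycle b d).1, (torus_cocycle a b).2 + (torus_cocycle b d).2).
Proof.
move=> ht ha hb hd; apply/eqP.
have : all (fun t => all (fun a => all (fun b => all (fun d => torus_cocycle a d ==
  ((torus_cocycle a b).1 + (torus_cocycle b d).1, (torus_cocycle a b).2 + (torus_cocycle b d).2))
  t) t) t) torus_triangles by vm_compute.
by move=> /allP/(_ t ht)/allP/(_ a ha)/allP/(_ b hb)/allP/(_ d hd).
Qed.

Lemma torus_triangle_lt t a : t \in torus_triangles -> a \in t -> (a < 7)%N.
Proof.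
move=> ht ha; have : all (all (fun a => a < 7)%N) torus_triangles by vm_compute.
by move=> /allP/(_ t ht)/allP/(_ a ha).
Qed.

End Torus.

(** * Gluing tori along an edge colouring *)

Section TorusComplex.
Variables (m q : nat) (col : 'I_m -> 'I_m -> 'I_q).
Hypothesis colC : forall i j, col i j = col j i.
Hypothesis col_inj : forall i j k, i != j -> i != k -> col i j = col i k -> j = k.
Hypothesis q_gt0 : (0 < q)%N.

(* [None] is the base point, [gen i false] and [gen i true] span with it the triangle
   carrying the [i]-th generator, and [aux f _] are the two vertices of the colour [f]. *)
Definition tvertex : finType := option (('I_m + 'I_q) * bool).
Definition gen (i : 'I_m) (b : bool) : tvertex := Some (inl i, b).
Definition aux (f : 'I_q) (b : bool) : tvertex := Some (inr f, b).

(* The vertices 0, 1, 3 span a triangle of the torus, so tori of equal colour meet in it. *)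
Definition torus_map (i j : 'I_m) (a : nat) : tvertex :=
  match a with
  | 0 => None
  | 1 => aux (col i j) false
  | 3 => aux (col i j) true
  | 2 => gen i false
  | 4 => gen i true
  | 6 => gen j false
  | _ => gen j true
  end.

(** Only the boundary of the triangle is put in; the triangle stays hollow, so that it can carry a
    generator. *)
Definition generator_edges i : seq (seq tvertex) :=
  [:: [:: None; gen i false]; [:: None; gen i true]; [:: gen i false; gen i true]].

(** The generator edges and the auxiliary triangles also occur inside tori; listing them separately
    keeps a generator that is in no pair and the vertices of a colour that no pair has. *)
Definition torus_facets : seq (seq tvertex) :=
  [seq map (torus_map p.1 p.2) t |
    p <- [seq p : 'I_m * 'I_m <- enum {: 'I_m * 'I_m} | (p.1 < p.2)%N], t <- torus_triangles] ++
  (flatten [seq generator_edges i | i <- enum 'I_m] ++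
   [seq [:: None; aux f false; aux f true] | f <- enum 'I_q]).

Variant facet_spec (F : seq tvertex) : Prop :=
| FacetTorus (i j : 'I_m) t of (i < j)%N & t \in torus_triangles & F = map (torus_map i j) t
| FacetEdge i of F \in generator_edges i
| FacetAux f of F = [:: None; aux f false; aux f true].

Lemma facetP F : reflect (facet_spec F) (F \in torus_facets).
Proof.
apply: (iffP idP).
  rewrite !mem_cat => /orP[|/orP[]].
  - move=> /allpairsP[[[i j] t] /= [h ht ->]].
    by move: h; rewrite mem_filter => /andP[ij _]; exact: FacetTorus ij ht _.
  - by move=> /flattenP[s /mapP[i _ ->]]; exact: FacetEdge.
  - by move=> /mapP[f _ ->]; exact: FacetAux.
case=> [i j t ij ht ->|i hi|f ->]; rewrite !mem_cat.
- apply/orP; left; apply/allpairsP; exists ((i, j), t); split=> //=.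
  by rewrite mem_filter ij mem_enum.
- apply/orP; right; apply/orP; left; apply/flattenP; exists (generator_edges i) => //.
  by apply: map_f; rewrite mem_enum.
- apply/orP; right; apply/orP; right; apply/mapP; exists f => //.
  by rewrite mem_enum.
Qed.

Definition facet_tri (a b d : tvertex) : Prop :=
  exists2 F, F \in torus_facets & [/\ a \in F, b \in F & d \in F].

Definition facet_adj : rel tvertex :=
  fun a b => has (fun F => (a \in F) && (b \in F)) torus_facets.

Lemma facet_adjP a b : reflect (facet_tri a b b) (facet_adj a b).
Proof.
apply: (iffP hasP) => [[F hF /andP[ha hb]]|[F hF [ha hb _]]].
  by exists F.
by exists F; rewrite // ha.
Qed.

Lemma facet_tri_torus (i j : 'I_m) a b d : (i < j)%N -> torus_tri a b d ->
  facet_tri (torus_map i j a) (torus_map i j b) (torus_map i j d).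
Proof.
move=> ij /hasP[t ht /and3P[ha hb hd]]; exists (map (torus_map i j) t).
  by apply/facetP; exact: FacetTorus ij ht _.
by split; exact: map_f.
Qed.

Lemma facet_tri_base : facet_tri None None None.
Proof.
exists [:: None; aux (Ordinal q_gt0) false; aux (Ordinal q_gt0) true].
  by apply/facetP; exact: FacetAux.
by rewrite inE.
Qed.

Lemma facet_tri_gen0 i b : facet_tri None (gen i b) (gen i b).
Proof.
exists [:: None; gen i b]; last by rewrite !inE !eqxx.
by apply/facetP; apply: (@FacetEdge _ i); case: b; rewrite !inE eqxx ?orbT.
Qed.

Lemma facet_tri_gen i b b' : facet_tri (gen i b) (gen i b') (gen i b').
Proof.
exists [:: gen i false; gen i true]; last by case: b b' => [] []; rewrite !inE !eqxx ?orbT.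
by apply/facetP; apply: (@FacetEdge _ i); rewrite !inE eqxx !orbT.
Qed.

Lemma facet_triP a b d a' b' d' : facet_tri a b d ->
  all (mem [:: a; b; d]) [:: a'; b'; d'] -> facet_tri a' b' d'.
Proof.
move=> [F hF [ha hb hd]] /= /and4P[h1 h2 h3 _].
have sub x : x \in [:: a; b; d] -> x \in F by rewrite !inE => /or3P[] /eqP ->.
by exists F => //; split; exact: sub.
Qed.

(** As the colouring is proper, colour [f] at [i] determines the other index, hence the one torus
    containing vertices of both [i] and [f]. *)
Definition partner (f : 'I_q) (i : 'I_m) : option 'I_m :=
  [pick k | (k != i) && (col i k == f)].

Lemma partner_col i j : i != j -> partner (col i j) i = Some j.
Proof.
move=> ij; rewrite /partner; case: pickP => [k /andP[ki /eqP hk]|/(_ j)]; last first.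
  by rewrite eq_sym ij eqxx.
by congr Some; apply: esym; apply: col_inj ij _ _; rewrite // eq_sym.
Qed.

Definition max_basis (i j : 'I_m) := if (i < j)%N then basis j else basis i.

(** The values of [torus_cocycle] in the torus determined by the two vertices, with its coordinates
    read as the basis vectors of the smaller and the larger index; [cocycle] antisymmetrises
    them. *)
Definition half_cocycle (a b : tvertex) : 'rV[int]_m :=
  match a, b with
  | Some (inl i, false), Some (inl j, true) => if (i <= j)%N then basis i else 0
  | Some (inl i, false), Some (inr f, false) =>
      if partner f i is Some p then max_basis i p else 0
  | Some (inr f, false), Some (inl i, true) =>
      if partner f i is Some p then if (i < p)%N then basis i - basis p else 0 else 0
  | Some (inr f, true), Some (inl i, false) =>
      if partner f i is Some p then if (i < p)%N then 0 else basis p - basis i else 0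
  | Some (inr f, true), Some (inl i, true) =>
      if partner f i is Some p then if (i < p)%N then basis i - basis p else basis p else 0
  | _, _ => 0
  end.

Definition cocycle (a b : tvertex) : 'rV[int]_m := half_cocycle a b - half_cocycle b a.

(** Properness of the colouring enters here, through [partner_col]: it makes the global cocycle
    restrict correctly to every torus. The 49 pairs of labels are then checked one by one. *)
Lemma cocycle_torus (i j : 'I_m) a b : (i < j)%N -> (a < 7)%N -> (b < 7)%N ->
  cocycle (torus_map i j a) (torus_map i j b) =
  basis i *~ (torus_cocycle a b).1 + basis j *~ (torus_cocycle a b).2.
Proof.
move=> ij.
have nij : i != j by rewrite neq_ltn ij.
have pi : partner (col i j) i = Some j by exact: partner_col.
have pj : partner (col i j) j = Some i by rewrite colC; apply: partner_col; rewrite eq_sym.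
have ji : (j < i)%N = false by apply/negbTE; rewrite -leqNgt ltnW.
have ji' : (j <= i)%N = false by apply/negbTE; rewrite -ltnNge.
have simp := (pi, pj, ij, ji, ji', ltnW ij, leqnn, subr0, sub0r, oppr0, opprB, addr0,
  add0r, mulr0z, mulr1z, mulrN1z, subrr).
case: a => [|[|[|[|[|[|[|a]]]]]]] // _; case: b => [|[|[|[|[|[|[|b]]]]]]] // _.
all: rewrite /cocycle /= /max_basis ?simp //.
all: by rewrite addrC.
Qed.

Lemma cocycle_pair x y a b d : a \in [:: x; y] -> b \in [:: x; y] -> d \in [:: x; y] ->
  cocycle a d = cocycle a b + cocycle b d.
Proof.
have c0 z : cocycle z z = 0 by rewrite /cocycle subrr.
have cN z z' : cocycle z z' + cocycle z' z = 0 by rewrite /cocycle addrA subrK subrr.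
by rewrite !inE => /orP[] /eqP -> /orP[] /eqP -> /orP[] /eqP ->; rewrite !(c0, cN, addr0, add0r).
Qed.

Lemma cocycleP F a b d : F \in torus_facets -> a \in F -> b \in F -> d \in F ->
  cocycle a d = cocycle a b + cocycle b d.
Proof.
move=> /facetP[i j t ij ht -> /mapP[a' ha ->] /mapP[b' hb ->] /mapP[d' hd ->]|i|f ->].
- rewrite !cocycle_torus ?(torus_triangle_lt ht) //.
  by rewrite (torus_cocycleP ht ha hb hd) /= !mulrzDr addrACA.
- by rewrite !inE => /or3P[] /eqP ->; exact: cocycle_pair.
(* The cocycle vanishes on the triangle shared by the tori of one colour. *)
- by rewrite !inE => /or3P[] /eqP -> /or3P[] /eqP -> /or3P[] /eqP ->;
    rewrite /cocycle /= !subr0 addr0.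
Qed.

Notation edge_eqv := (eqv facet_tri).

(** The return to the base point is left to whatever follows, so blocks can be concatenated. *)
Definition block (l : 'I_m * bool) : seq tvertex := [:: None; gen l.1 (~~ l.2); gen l.1 l.2].

Definition word_path (w : seq ('I_m * bool)) : seq tvertex := flatten (map block w).

Lemma word_path_cat u v : word_path (u ++ v) = word_path u ++ word_path v.
Proof. by rewrite /word_path map_cat flatten_cat. Qed.

Definition lift_letter (i j : 'I_m) (l : bool * bool) := (if l.1 then j else i, l.2).

Lemma map_torus_path i j w :
  map (torus_map i j) (torus_path w) = word_path (map (lift_letter i j) w).
Proof.
elim: w => // l w IH; rewrite /torus_path /= map_cat -/(torus_path w) IH.
by case: l => [[] []].
Qed.

Lemma torus_word_exp i j x :
  word_exp (map (lift_letter i j) (torus_word x)) = basis i *~ x.1 + basis j *~ x.2.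
Proof. by rewrite map_cat !map_nseq word_exp_cat -!power_word_exp. Qed.

Lemma base_tri_eqv a b : facet_tri None a b -> edge_eqv [:: None; a; b] [:: None; b].
Proof. exact: (@eqv_tri _ _ [::]). Qed.

(** Torus edges are transported by [torus_map]; on a generator triangle the side opposite the base
    point gives one letter; all other edges bound a face with the base point, on which the cocycle
    vanishes. *)
Lemma facet_edge_eqv a b : facet_tri a b b -> exists w,
  edge_eqv [:: None; a; b] (word_path w ++ [:: None; b]) /\ word_exp w = cocycle a b.
Proof.
have triv : facet_tri None a b -> cocycle a b = 0 -> exists w,
    edge_eqv [:: None; a; b] (word_path w ++ [:: None; b]) /\ word_exp w = cocycle a b.
  by move=> h ->; exists [::]; split; [exact: base_tri_eqv | rewrite /word_exp big_nil].
move=> [F hF [ha hb _]]; case/facetP: (hF) ha hb => [i j t ij ht ->|i hi|f E].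
- move=> /mapP[a' ha ->] /mapP[b' hb ->].
  have la := torus_triangle_lt ht ha; have lb := torus_triangle_lt ht hb.
  exists (map (lift_letter i j) (torus_word (torus_cocycle a' b'))); split.
    have := eqv_map (fun a b d => @facet_tri_torus i j a b d ij) (torus_edge_eqv la lb).
    by rewrite map_cat map_torus_path.
  by rewrite torus_word_exp cocycle_torus.
- move=> ha hb; have baseF : None \in F -> facet_tri None a b by exists F.
  have [a0|an] := eqVneq a None.
    apply: triv; last by rewrite a0 /cocycle /=; case: (b) => [[[j|f] []]|] /=; rewrite subrr.
    by rewrite a0 in ha *; exists F.
  have [b0|bn] := eqVneq b None.
    apply: triv; last by rewrite b0 /cocycle /=; case: (a) => [[[j|f] []]|] /=; rewrite subrr.
    by rewrite b0 in hb *; exists F.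
  have isgen x : x \in F -> x != None -> exists c, x = gen i c.
    move: hi; rewrite !inE => /or3P[] /eqP -> ; rewrite !inE => /orP[] /eqP -> //;
      move=> _; solve [by exists false | by exists true].
  have [x ax] := isgen a ha an; have [y bY] := isgen b hb bn.
  have [E|ne] := eqVneq x y.
    apply: triv; last by rewrite ax bY E /cocycle subrr.
    by rewrite ax bY E; exact: facet_tri_gen0.
  have Ey : y = ~~ x by case: x y ne {ax bY} => [] [].
  exists [:: (i, y)]; rewrite ax bY Ey word_exp1 /=; split.
    rewrite /block /= negbK.
    apply: eqv_sym; apply: eqv_trans (_ : edge_eqv _ [:: None; gen i x; gen i (~~ x); gen i (~~ x)]) _.
      apply: (@eqv_tri _ _ [:: None; gen i x]).
      by apply: facet_triP (facet_tri_gen0 i (~~ x)) _; rewrite /= !inE !eqxx ?orbT.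
    by apply: (@eqv_tri _ _ [:: None]); exact: facet_tri_gen.
  rewrite /letter_exp /cocycle; case: (x) => /=; rewrite leqnn ?subr0 ?sub0r //.
- move=> ha hb; apply: triv.
    by exists F => //; rewrite {1}E inE.
  by move: ha hb; rewrite E !inE => /or3P[] /eqP -> /or3P[] /eqP ->; rewrite /cocycle /= subr0.
Qed.

(** The path is pulled through the base point one edge at a time, leaving a word behind. *)
Lemma path_eqv p s : path facet_adj p s -> exists w,
  edge_eqv [:: None, p & s] (word_path w ++ [:: None; last p s]) /\
  word_exp w = csum cocycle None (p :: s).
Proof.
have c0 a : cocycle a None = 0 by rewrite /cocycle; case: a => [[[i|f] []]|] /=; rewrite subrr.
elim: s p => [|b s IH] p /=.
  move=> _; exists [::]; split; first exact: eqv_refl.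
  by rewrite c0 addr0 /word_exp big_nil.
move=> /andP[/facet_adjP pb /IH[w2 [e2 x2]]].
have [w1 [e1 x1]] := facet_edge_eqv pb; exists (w1 ++ w2); split.
  apply: eqv_trans (eqv_catr s e1) _; rewrite word_path_cat -!catA /=.
  exact: eqv_catl.
by rewrite word_exp_cat x1 x2.
Qed.

Lemma closed_path_word cw : closed_path facet_adj None cw -> exists w,
  edge_eqv cw (word_path w ++ [:: None]) /\ word_exp w = csum cocycle None cw.
Proof.
case: cw => // a s /and3P[/eqP -> /eqP ls /path_eqv[w [e x]]]; exists w; split=> //.
(* [path_eqv] expects a base point in front of the path, so the initial one is doubled; the double
   one left at the end is removed afterwards. *)
apply: eqv_trans (eqv_sym (@eqv_dup _ _ [::] None s facet_tri_base)) _.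
rewrite ls in e; apply: eqv_trans e _.
exact: (@eqv_dup _ _ (word_path w) None [::] facet_tri_base).
Qed.

Definition word_eqv w w' := edge_eqv (word_path w ++ [:: None]) (word_path w' ++ [:: None]).

Lemma word_path_head v : exists X, word_path v ++ [:: None] = None :: X.
Proof. by case: v => [|l v]; [exists [::] | eexists; rewrite /= -/word_path]. Qed.

(** Whatever follows starts at [None], which serves as the closing base point in [word_eqv]. *)
Lemma word_eqv_cat u v w w' : word_eqv w w' -> word_eqv (u ++ w ++ v) (u ++ w' ++ v).
Proof.
rewrite /word_eqv !word_path_cat -!catA => e; apply: eqv_catl.
have [X ->] := word_path_head v.
by have := eqv_catr X e; rewrite -!catA.
Qed.

Lemma word_eqv_cancel i b : word_eqv [:: (i, b); (i, ~~ b)] [::].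
Proof.
rewrite /word_eqv /word_path /= negbK; set u := gen i (~~ b); set v := gen i b.
have vu c d : facet_tri (gen i c) (gen i d) (gen i c).
  by apply: facet_triP (facet_tri_gen i c d) _; rewrite /= !inE !eqxx ?orbT.
have v0 c : facet_tri (gen i c) None (gen i c).
  by apply: facet_triP (facet_tri_gen0 i c) _; rewrite /= !inE !eqxx ?orbT.
(* The path [None u v None v u None] is retracted from its middle outwards. *)
apply: eqv_trans (@eqv_tri _ _ [:: None; u] v None v [:: u; None] (v0 _)) _.
apply: eqv_trans (@eqv_tri _ _ [:: None] u v v [:: u; None] (facet_tri_gen _ _ _)) _.
apply: eqv_trans (@eqv_tri _ _ [:: None] u v u [:: None] (vu _ _)) _.
apply: eqv_trans (@eqv_tri _ _ [::] None u u [:: None] (facet_tri_gen0 _ _)) _.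
apply: eqv_trans (@eqv_tri _ _ [::] None u None [::] _) _.
  by apply: facet_triP (facet_tri_gen0 i (~~ b)) _; rewrite /= !inE !eqxx ?orbT.
exact: (@eqv_dup _ _ [::] None [::] facet_tri_base).
Qed.

(** Commutation is carried over from the torus glued in for the pair, which is indexed with the
    smaller generator first. *)
Lemma word_eqv_comm l l' : l.1 != l'.1 -> word_eqv [:: l; l'] [:: l'; l].
Proof.
wlog ij : l l' / (l.1 < l'.1)%N => [H ll|_].
  have [h|h] := ltnP l.1 l'.1; first exact: H.
  by apply: eqv_sym; apply: H; rewrite 1?eq_sym // ltn_neqAle h andbT eq_sym.
have := eqv_map (fun a b d => @facet_tri_torus _ _ a b d ij) (torus_comm_eqv l.2 l'.2).
by rewrite !(map_cat _ (torus_path _)) !map_torus_path; case: l l' {ij} => i b [j b'].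
Qed.

Lemma word_eqv_of_exp w w' : word_exp w = word_exp w' -> word_eqv w w'.
Proof.
apply: weq_of_exp.
- by move=> ?; exact: eqv_refl.
- by move=> ? ?; exact: eqv_sym.
- by move=> ? ? ?; exact: eqv_trans.
- exact: word_eqv_cat.
- exact: word_eqv_cancel.
- exact: word_eqv_comm.
Qed.

Lemma csum_injective w w' : closed_path facet_adj None w -> closed_path facet_adj None w' ->
  csum cocycle None w = csum cocycle None w' -> edge_eqv w w'.
Proof.
move=> /closed_path_word[u [e x]] /closed_path_word[u' [e' x']] E.
apply: eqv_trans e (eqv_trans _ (eqv_sym e')).
by apply: word_eqv_of_exp; rewrite x x'.
Qed.

Lemma word_path_closed w : closed_path facet_adj None (word_path w ++ [:: None]) /\
  csum cocycle None (word_path w ++ [:: None]) = word_exp w.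
Proof.
elim: w => [|[i b] w [IH1 IH2]].
  by split=> //=; rewrite /cocycle /= subrr addr0 /word_exp big_nil.
have [X EX] := word_path_head w.
rewrite -cat1s word_path_cat word_exp_cat word_exp1 -catA -IH2 EX; move: IH1.
rewrite EX /= => /andP[-> ->]; split.
  rewrite !andbT /=; apply/and3P; split; apply/facet_adjP.
  - exact: facet_tri_gen0.
  - exact: facet_tri_gen.
  - by apply: facet_triP (facet_tri_gen0 i b) _; rewrite /= !inE !eqxx ?orbT.
rewrite addrA addrA; congr (_ + _).
by rewrite /letter_exp /cocycle; case: b; rewrite /= leqnn !(subrr, subr0, sub0r, addr0, add0r, oppr0).
Qed.

Lemma csum_surjective z : exists2 w, closed_path facet_adj None w & csum cocycle None w = z.
Proof.
exists (word_path (normal_word (enum 'I_m) z) ++ [:: None]).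
  by case: (word_path_closed (normal_word (enum 'I_m) z)).
by case: (word_path_closed (normal_word (enum 'I_m) z)) => _ ->; exact: normal_word_exp.
Qed.

End TorusComplex.

(** * The geometric complex *)

Section Transfer.
Variables (m q : nat) (col : 'I_m -> 'I_m -> 'I_q).
Hypothesis colC : forall i j, col i j = col j i.
Hypothesis col_inj : forall i j k, i != j -> i != k -> col i j = col i k -> j = k.
Hypothesis q_gt0 : (0 < q)%N.

Let V : finType := tvertex m q.
Let facets : seq (seq V) := torus_facets col.

Definition torus_complex : {set {set 'I_#|V|}} := finset.finset (fun sg : {set 'I_#|V|} =>
  (sg != finset.set0) && has (fun F => [forall p in sg, enum_val p \in F]) facets).

Lemma torus_complexP (sg : {set 'I_#|V|}) : reflect
  (sg != finset.set0 /\ exists2 F, F \in facets & forall p, p \in sg -> enum_val p \in F)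
  (sg \in torus_complex).
Proof.
rewrite inE; apply: (iffP andP) => -[h H]; split=> //.
  by case/hasP: H => F hF /forall_inP; exists F.
by case: H => F hF H; apply/hasP; exists F => //; apply/forall_inP.
Qed.

Lemma torus_complex_simplicial : is_simplicial_complex torus_complex.
Proof.
split=> [s /torus_complexP[] //|s t /torus_complexP[_ [F hF H]] /fintype.subsetP ts t0].
by apply/torus_complexP; split=> //; exists F => // p /ts; exact: H.
Qed.

Lemma torus_complex_cosimplicial a b d : facet_tri col (enum_val a) (enum_val b) (enum_val d) ->
  cosimplicial torus_complex a b d.
Proof.
move=> [F hF [ha hb hd]].
exists (finset.finset (fun x => x \in [:: a; b; d])); last by rewrite !inE !eqxx !orbT.
apply/torus_complexP; split; first by apply/finset.set0Pn; exists a; rewrite !inE eqxx.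
by exists F => // p; rewrite !inE => /or3P[] /eqP ->.
Qed.

Lemma torus_complex_adjacent a b :
  adjacent torus_complex a b = facet_adj col (enum_val a) (enum_val b).
Proof.
apply/torus_complexP/hasP => [[_ [F hF H]]|[F hF /andP[ha hb]]].
  by exists F => //; rewrite !H // !inE eqxx ?orbT.
split; first by apply/finset.set0Pn; exists a; rewrite !inE eqxx.
by exists F => // p; rewrite !inE => /orP[] /eqP ->.
Qed.

Lemma torus_complex_vertex i : finset.set1 i \in torus_complex.
Proof.
apply/torus_complexP; split; first by apply/finset.set0Pn; exists i; rewrite inE.
suff [F hF hi] : exists2 F, F \in facets & enum_val i \in F.
  by exists F => // p; rewrite inE => /eqP ->.
case: (enum_val i) => [[[j|f] b]|].
- exists [:: None; gen q j b]; last by rewrite !inE eqxx orbT.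
  by apply/facetP; apply: (@FacetEdge _ _ _ _ j); case: b; rewrite !inE eqxx ?orbT.
- exists [:: None; aux m f false; aux m f true]; first by apply/facetP; exact: FacetAux.
  by case: b; rewrite !inE eqxx ?orbT.
- exists [:: None; aux m (Ordinal q_gt0) false; aux m (Ordinal q_gt0) true]; last by rewrite inE.
  by apply/facetP; exact: FacetAux.
Qed.

Lemma closed_path_map v w : enum_val v = None ->
  closed_path (adjacent torus_complex) v w =
  closed_path (facet_adj col) None (map (@enum_val V predT) w).
Proof.
move=> v0; case: w => //= a s; rewrite last_map path_map -v0 !(inj_eq enum_val_inj).
by congr [&& _, _ & _]; apply: eq_path => x y; exact: torus_complex_adjacent.
Qed.

Lemma csum_map (A : zmodType) (c : V -> V -> A) v w : enum_val v = None ->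
  csum (fun a b : 'I_#|V| => c (enum_val a) (enum_val b)) v w =
  csum c None (map (@enum_val V predT) w).
Proof.
move=> v0; elim: w => //= a s ->; congr (c _ _ + _).
by case: s => [|b s].
Qed.

Theorem torus_complex_pi1 : complex_with_pi1_Zpow #|V| m.
Proof.
exists torus_complex; split; first exact: torus_complex_simplicial.
split; first exact: torus_complex_vertex.
pose v0 : 'I_#|V| := enum_rank (None : V).
have ev0 : enum_val v0 = None by rewrite enum_rankK.
have v0K := torus_complex_vertex v0.
exists (vert v0); split.
  apply: (realization_sub torus_complex_simplicial v0K); first exact: simplex_vert.
  by move=> i; rewrite vertE pnatr_eq0 eqb0 negbK inE.
have mapK (w : seq 'I_#|V|) : map enum_rank (map (@enum_val V predT) w) = w.
  by rewrite -map_comp (eq_map enum_valK) map_id.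
have mapK' (w : seq V) : map (@enum_val V predT) (map enum_rank w) = w.
  by rewrite -map_comp (eq_map enum_rankK) map_id.
apply: (@pi1_iso_of_edge_paths _ _ _ torus_complex_simplicial v0K m
  (fun a b => cocycle col (enum_val a) (enum_val b))).
- move=> sg a b d /torus_complexP[_ [F hF H]] ha hb hd.
  by apply: (cocycleP colC col_inj hF); exact: H.
- move=> w w'; rewrite !closed_path_map // !csum_map // => cw cw' E.
  rewrite -[w]mapK -[w']mapK.
  apply: eqv_map (csum_injective colC col_inj q_gt0 cw cw' E) => a b d h.
  by apply: torus_complex_cosimplicial; rewrite !enum_rankK.
- move=> z; have [w cw Ez] := csum_surjective col z.
  by exists (map enum_rank w); rewrite ?closed_path_map ?csum_map ?mapK'.
Qed.

End Transfer.

(** * Vertex count and proper edge colourings of complete graphs *)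

Lemma card_tvertex m q : #|{: tvertex m q}| = (2 * (m + q)).+1.
Proof. by rewrite card_option card_prod card_sum !card_ord card_bool mulnC. Qed.

(* The edge from [i] to the extra vertex [q] gets the colour [2 i] that is missing at [i]. *)
Definition edge_colour (q i j : nat) : nat :=
  ((if i == q then 2 * j else if j == q then 2 * i else i + j) %% q)%N.

Lemma edge_colourC q i j : i != j -> edge_colour q i j = edge_colour q j i.
Proof.
move=> ij; rewrite /edge_colour addnC; case: eqVneq => [ei|_]; case: eqVneq => [ej|_] //.
by move: ij; rewrite ei ej eqxx.
Qed.

(** Modulo [q], sums [i + j] are injective in [j]; doubling is injective because [q] is odd; and
    [i + j = 2 * i] would force [j = i], so the edge to the extra vertex takes a free colour. *)
Lemma edge_colour_inj q i j k : odd q -> (i <= q)%N -> (j <= q)%N -> (k <= q)%N ->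
  i != j -> i != k -> edge_colour q i j = edge_colour q i k -> j = k.
Proof.
move=> oq iq jq kq ij ik; rewrite /edge_colour.
have dbl a b : (a < q)%N -> (b < q)%N -> (2 * a = 2 * b %[mod q])%N -> a = b.
  wlog ab : a b / (a <= b)%N => [H aq bq E|_ bq /esym/eqP].
    by case/orP: (leq_total a b) => h; [exact: H | apply/esym/H].
  rewrite eqn_mod_dvd ?leq_mul2l // -mulnBr Gauss_dvdr ?coprimen2 // => /dvdn_leq h.
  by have [|/h] := posnP (b - a); lia.
have add a b : (a < q)%N -> (b < q)%N -> (i + a = i + b %[mod q])%N -> a = b.
  by move=> aq bq /eqP; rewrite eqn_modDl !modn_small // => /eqP.
case: eqVneq => [ei|ni].
  apply: dbl; rewrite ltn_neqAle; apply/andP; split=> //; rewrite -ei eq_sym //.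
have ltiq : (i < q)%N by rewrite ltn_neqAle ni.
case: eqVneq => [ej|nj]; case: eqVneq => [ek|nk].
- by rewrite ej ek.
- rewrite mul2n -addnn => E.
  have e : i = k by apply: add => //; rewrite ltn_neqAle nk.
  by rewrite e eqxx in ik.
- rewrite mul2n -addnn => E.
  have e : i = j by apply: add => //; rewrite ltn_neqAle nj.
  by rewrite e eqxx in ij.
- by apply: add; rewrite ltn_neqAle ?nj ?nk.
Qed.

Theorem complex_Zpow m q : odd q -> (m <= q.+1)%N ->
  complex_with_pi1_Zpow (2 * (m + q)).+1 m.
Proof.
move=> oq mq; have q0 : (0 < q)%N by case: q oq mq.
(* On the diagonal the colour is a default value, since tori belong to pairs [i < j]. *)
pose col (i j : 'I_m) : 'I_q := if i == j then Ordinal q0 else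
  Ordinal (ltn_pmod (edge_colour q i j) q0).
rewrite -card_tvertex; apply: (@torus_complex_pi1 m q col) => //.
- move=> i j; rewrite /col eq_sym; case: eqVneq => // ij; apply: val_inj => /=.
  by rewrite edge_colourC // eq_sym.
- move=> i j k ij ik; rewrite /col (negbTE ij) (negbTE ik) => /(congr1 val) /=.
  rewrite !modn_mod => E; apply: val_inj; apply: (edge_colour_inj oq _ _ _ _ _ E) => //;
    by rewrite -ltnS; apply: leq_trans mq.
Qed.

Local Close Scope ring_scope.

Theorem mainTheorem5 :
  (forall n : nat, 1 <= n -> n != 2 -> n != 3 ->
     complex_with_pi1_Zpow (8 * n - 1) (2 * n) /\
     complex_with_pi1_Zpow (8 * n - 3) (2 * n - 1)) /\
  (exists C : nat, forall m : nat,
     exists N : nat, N <= C * m + C /\ complex_with_pi1_Zpow N m).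
Proof.
split=> [n n1 _ _|].
  (* Both parts use [q = 2 * n - 1] colours, an odd number with [m <= q + 1] for [m = 2 * n] and for
     [m = 2 * n - 1]. *)
  have oq : odd (2 * n - 1) by rewrite oddB ?muln_gt0 // mul2n odd_double.
  split.
    have -> : 8 * n - 1 = (2 * (2 * n + (2 * n - 1))).+1 by lia.
    by apply: complex_Zpow => //; lia.
  have -> : 8 * n - 3 = (2 * ((2 * n - 1) + (2 * n - 1))).+1 by lia.
  by apply: complex_Zpow => //; lia.
(* The odd number [q = 2 * m + 1] works for every [m] and gives [6 * m + 3] vertices. *)
exists 6 => m; exists (2 * (m + (2 * m).+1)).+1; split; first lia.
by apply: complex_Zpow; [rewrite /= mul2n odd_double | lia].
Qed.
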